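(* Let $\{S_k; k\ge 1\}$ be a nondecreasing sequence of positive random variables. Suppose there exist a standard Wiener process $\{W(t); t\ge 0\}$ and two positive constants $\mu$ and $\sigma$ such that $$W_n(t):=\frac{S_{[nt]}-[nt]\mu}{\sigma\sqrt{n}}\ \xrightarrow{\mathscr D}\ W(t)\quad\text{in } D[0,1],\ \text{as } n\to\infty,$$ and $$\sup_n \frac{E|S_n-n\mu|}{\sqrt{n}}<\infty.$$ Then, with $\gamma=\mu/\sigma$, $$\left(\prod_{k=1}^{[nt]}\frac{S_k}{k\mu}\right)^{\gamma/\sqrt{n}}\ \xrightarrow{\mathscr D}\ \exp\left\{\int_0^t\frac{W(x)}{x}\,dx\right\}\quad\text{in } D[0,1],\ \text{as } n\to\infty.$$
   Context: $[x]$ denotes the integer part of $x$; an empty product (when $[nt]=0$) equals $1$. $D[0,1]$ is the Skorokhod space of càdlàg functions on $[0,1]$, and $\xrightarrow{\mathscr D}$ denotes convergence in distribution (weak convergence of the processes in $D[0,1]$). *)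

(* Defs.v *)
From HB Require Import structures.
From mathcomp Require Import all_boot all_order all_algebra.
From mathcomp Require Import all_classical all_reals all_analysis.
Set Implicit Arguments. Unset Strict Implicit. Unset Printing Implicit Defensive.
Import Order.TTheory GRing.Theory Num.Theory.
Import numFieldNormedType.Exports.
Local Open Scope classical_set_scope.
Local Open Scope ring_scope.

(* x : R -> R is cadlag on [0,1] (only values on [0,1] matter) *)
Definition cadlag01 {R : realType} (x : R -> R) : Prop :=
  (forall t, 0 <= t < 1 -> x @ at_right t --> x t) /\
  (forall t, 0 < t <= 1 -> cvg (x @ at_left t)).

Definition time_change {R : realType} (lam : R -> R) : Prop :=
  {within `[0, 1], continuous lam} /\ lam 0 = 0 /\ lam 1 = 1 /\
  {in `[0, 1] &, forall s t, s < t -> lam s < lam t}.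

(* d_J1(x, y) < delta for the Skorokhod J1 metric on [0,1]:
   d_J1(x,y) = inf_lam max(sup_t |lam t - t|, sup_t |x t - y (lam t)|) *)
Definition skorokhod_lt {R : realType} (x y : R -> R) (delta : R) : Prop :=
  exists lam : R -> R, time_change lam /\
    exists c : R, c < delta /\
      forall t, 0 <= t <= 1 -> `|lam t - t| <= c /\ `|x t - y (lam t)| <= c.

Definition skorokhod_continuous {R : realType} (f : (R -> R) -> R) : Prop :=
  forall x, cadlag01 x -> forall eps : R, 0 < eps -> exists2 delta : R, 0 < delta &
    forall y, cadlag01 y -> skorokhod_lt x y delta -> `|f x - f y| < eps.

Definition bounded_functional {R : realType} (f : (R -> R) -> R) : Prop :=
  exists M : R, forall x, `|f x| <= M.

(* Convergence in distribution in D[0,1]: X n (defined on (Omega1,P1)) converges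
   weakly to Y (defined on (Omega2,P2)): E f(X n) --> E f(Y) for every bounded
   Skorokhod-continuous functional f (measurability of f o X n and f o Y,
   which always holds since the Borel sigma-algebra of D[0,1] is generated by
   the coordinate maps, is listed as a side condition). *)
Definition conv_in_distr_D {R : realType} {d1 d2 : measure_display}
  {Omega1 : measurableType d1} {Omega2 : measurableType d2}
  (P1 : probability Omega1 R) (X : nat -> Omega1 -> R -> R)
  (P2 : probability Omega2 R) (Y : Omega2 -> R -> R) : Prop :=
  forall f : (R -> R) -> R, bounded_functional f -> skorokhod_continuous f ->
    (forall n, measurable_fun [set: Omega1] (fun w => f (X n w))) ->
    measurable_fun [set: Omega2] (fun w => f (Y w)) ->
    (fun n => (\int[P1]_w (f (X n w))%:E)%E) @ \oo
      --> (\int[P2]_w (f (Y w))%:E)%E.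

Definition mutually_independent {R : realType} {d : measure_display}
  {Omega : measurableType d} (P : probability Omega R) (n : nat)
  (X : 'I_n -> Omega -> R) : Prop :=
  forall B : 'I_n -> set R, (forall i, measurable (B i)) ->
    P (\bigcap_(i in [set: 'I_n]) (X i @^-1` B i)) =
    (\prod_(i < n) P (X i @^-1` B i))%E.

Definition standard_wiener {R : realType} {d : measure_display}
  {Omega : measurableType d} (P : probability Omega R) (W : R -> Omega -> R) : Prop :=
  (forall t, 0 <= t -> measurable_fun [set: Omega] (W t)) /\
  (forall w, W 0 w = 0) /\
  (forall w, {within `[0, +oo[, continuous (fun t => W t w)}) /\
  (forall s t, 0 <= s -> s < t -> forall B : set R, measurable B ->
     P ((fun w => W t w - W s w) @^-1` B) = normal_prob 0 (Num.sqrt (t - s)) B) /\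
  (forall (n : nat) (tt : nat -> R), 0 <= tt 0%N ->
     (forall i, (i < n)%N -> tt i < tt i.+1) ->
     mutually_independent P (fun i : 'I_n => fun w => W (tt i.+1) w - W (tt i) w)).

Definition S0ext {R : realType} {T : Type} (S : nat -> T -> R) (k : nat) (w : T) : R :=
  if k is 0%N then 0 else S k w.

Definition intpart {R : realType} (x : R) : nat := Num.truncn x.

(* Main.v *)
(** Write [W_n] for the normalized partial-sum process and [z_n] for the logarithm of the
normalized product. With [x_k = S_k / (k mu) - 1], one has
[z_n(t) = (gamma / sqrt n) * sum_{k <= nt} ln (1 + x_k)]. Monotonicity of [S] and the
first-moment bound along [k = j^4] make [x_k] uniformly small for large [k] with high
probability, so [ln (1 + x_k)] may be replaced by [x_k], with an error whose expectation is
controlled by the first-moment bound; hence [z_n] is uniformly close to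
[t |-> \int_0^t W_n(s) / s ds], and also to the integral cut off below [e], uniformly in [n].

The cut-off integral is continuous from the Skorokhod topology to the uniform one. Given a
bounded Skorokhod-continuous [F], composing it with a Lipschitz minorant (inf-convolution for
the uniform distance) of [z |-> F (exp z)] gives a functional to which the convergence of
[W_n] applies. Letting the cut-off and the Lipschitz constant tend to their limits jointly
yields [liminf E F(Y_n) >= E F(Y)]; the same for [- F] gives the theorem. Almost sure
integrability of [W(s) / s] at 0 also comes from the hypotheses: the truncated functionals
[\int_e^1 |x(s)| s^(-5/4) ds] are Skorokhod-continuous with bounded expectation along [W_n]. *)

Require Import Defs.
From HB Require Import structures.
From mathcomp Require Import all_boot all_order all_algebra.
From mathcomp Require Import all_classical all_reals all_analysis.
From mathcomp Require Import measurable_realfun ring lra.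
Import Order.TTheory GRing.Theory Num.Theory.
Import numFieldNormedType.Exports.
Local Open Scope classical_set_scope.
Local Open Scope ring_scope.
Set Implicit Arguments. Unset Strict Implicit. Unset Printing Implicit Defensive.

(** * Cadlag paths *)

(** The integral of [x s / s] is not defined on all of D[0,1], so the continuous mapping theorem
    does not apply to it. Cutting off at [e] restores continuity but leaves an error that is small
    only in expectation, of order [e^(1/4)] uniformly in [n]. An error small in mean is harmless for
    a Lipschitz test functional, whereas [F] after the exponential is merely continuous. A minorant
    with Lipschitz constant [L] costs [L * e^(1/4)], which vanishes for [L = m], [e = (m + 1)^(-8)];
    being a minorant, it yields one-sided estimates only.

    The exponents come from [E |S_k - k mu| <= C sqrt k], so that [E |W_n(s)|] is of order [sqrt s]:
    against [s^(-5/4)] this leaves [s^(-3/4)], whose integral over the unit interval is 4, the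
    origin of the constant [4 * C / sigma]. Along [j^4] the expected relative errors are of order
    [j^(-2)], a summable series, while consecutive fourth powers still have ratio tending to 1. The
    logarithms of the first factors may have no expectation; there are finitely many of them, and
    after truncation the factor [1 / sqrt n] removes them by bounded convergence. *)

Section cadlag.
Context {R : realType}.
Implicit Types (x y z : R -> R) (a b c e h l s t u v K : R).

(** Compactness in one-sided form, suited to cadlag paths: their estimates hold on small intervals
    to the right and to the left of each point, with different reference values. Let [c] be the
    supremum of the [s] with [A a s]: the left condition shows [A a c], and the right condition
    would carry [A] beyond any [c < b]. *)
Lemma interval_induction (A : R -> R -> Prop) a b : a < b ->
  (forall u v (w : R), a <= u -> u < v -> v < w -> w <= b ->
    A u v -> A v w -> A u w) ->
  (forall t, a <= t < b -> exists2 h, 0 < h &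
    forall v, t < v -> v < t + h -> v <= b -> A t v) ->
  (forall t, a < t <= b -> exists2 h, 0 < h &
    forall u, t - h < u -> u < t -> a <= u -> A u t) ->
  A a b.
Proof.
move=> ab Atrans Ar Al.
pose E := [set s | a < s <= b /\ A a s].
have Eub : ubound E b by move=> s [/andP[]].
have [s0 Es0] : E !=set0.
  have [|h h0 Ah] := Ar a; first by rewrite lexx.
  pose v := Num.min b (a + h / 2).
  have av : a < v by rewrite lt_min ab/=; lra.
  have vb : v <= b by rewrite ge_min lexx.
  have vh : v <= a + h / 2 by rewrite ge_min lexx orbT.
  by exists v; split; [apply/andP|apply: Ah => //; lra].
have hE : has_sup E by split; [exists s0|exists b].
pose c := sup E.
have cub : ubound E c by apply: sup_upper_bound.
have ac : a < c.
  by apply: lt_le_trans (cub _ Es0); case: Es0 => /andP[].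
have cb : c <= b by apply: ge_sup => //; exists s0.
have Aac : A a c.
  have [|h h0 Ah] := Al c; first by apply/andP.
  have [s Es hs] : exists2 s, E s & c - h < s.
    by apply: sup_adherent.
  have sc : s <= c by exact: cub.
  case: Es => /andP[as_ sb] As.
  move: sc; rewrite le_eqVlt => /predU1P[<-//|sc].
  by apply: (Atrans a s c) => //; apply: Ah => //; exact: ltW.
move: cb; rewrite le_eqVlt => /predU1P[<-//|cb].
have [|h h0 Ah] := Ar c; first by rewrite (ltW ac).
pose v := Num.min b (c + h / 2).
have cv : c < v by rewrite lt_min cb/=; lra.
have vb : v <= b by rewrite ge_min lexx.
have vh : v <= c + h / 2 by rewrite ge_min lexx orbT.
suff /cub : E v by rewrite leNgt cv.
split; first by rewrite vb andbT (lt_trans ac).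
by apply: (Atrans a c v) => //; apply: Ah => //; lra.
Qed.

Lemma cadlag01_right x t : cadlag01 x -> 0 <= t < 1 ->
  forall e, 0 < e -> exists2 h, 0 < h &
    forall s, t <= s -> s < t + h -> `|x s - x t| <= e.
Proof.
move=> [xr _] /xr /cvgrPdist_le xt e e0.
have := xt e e0; rewrite near_withinE => /nbhs_ballP[h /= h0 xh].
exists h => // s; rewrite le_eqVlt => /predU1P[<- _|ts sh].
  by rewrite subrr normr0 ltW.
by rewrite distrC; apply: xh => //; rewrite /ball/= distrC gtr0_norm; lra.
Qed.

Lemma cadlag01_left x t : cadlag01 x -> 0 < t <= 1 ->
  exists l, forall e, 0 < e -> exists2 h, 0 < h &
    forall s, t - h < s -> s < t -> `|x s - l| <= e.
Proof.
move=> [_ xl] /xl /cvg_ex[l /cvgrPdist_le xt]; exists l => e e0.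
have := xt e e0; rewrite near_withinE => /nbhs_ballP[h /= h0 xh].
exists h => // s hs st; rewrite distrC.
by apply: xh => //; rewrite /ball/= gtr0_norm; lra.
Qed.

Lemma cadlag01I x :
  (forall t, 0 <= t < 1 -> forall e, 0 < e -> exists2 h, 0 < h &
    forall s, t < s -> s < t + h -> `|x s - x t| <= e) ->
  (forall t, 0 < t <= 1 -> exists l, forall e, 0 < e -> exists2 h, 0 < h &
    forall s, t - h < s -> s < t -> `|x s - l| <= e) ->
  cadlag01 x.
Proof.
move=> xr xl; split => t t01.
  apply/cvgrPdist_le => e /(xr t t01)[h h0 xh].
  rewrite near_withinE; apply/nbhs_ballP; exists h => //= s.
  by rewrite /ball/= ltr_distlC => /andP[hs sh] ts; rewrite distrC xh.
have [l {}xl] := xl t t01; apply/cvg_ex; exists l.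
apply/cvgrPdist_le => e /xl[h h0 xh].
rewrite near_withinE; apply/nbhs_ballP; exists h => //= s.
by rewrite /ball/= ltr_distlC => /andP[hs sh] ts; rewrite distrC xh.
Qed.

Lemma unif_continuous_cadlag01 z :
  (forall e, 0 < e -> exists2 h, 0 < h & forall s t,
    0 <= s <= 1 -> 0 <= t <= 1 -> `|s - t| < h -> `|z s - z t| <= e) ->
  cadlag01 z.
Proof.
move=> zc; apply: cadlag01I => t /andP[t0 t1].
  move=> e /zc[h h0 zh]; exists (Num.min h (1 - t)).
    by rewrite lt_min h0/=; lra.
  move=> s ts; rewrite -ltrBlDl lt_min => /andP[sh s1].
  by apply: zh; [apply/andP; lra|apply/andP; lra|rewrite gtr0_norm//; lra].
exists (z t) => e /zc[h h0 zh]; exists (Num.min h t); first by rewrite lt_min h0.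
move=> s; rewrite ltrBlDr -ltrBlDl lt_min => /andP[sh s0] st.
by apply: zh; [apply/andP; lra|apply/andP; lra|rewrite ltr0_norm//; lra].
Qed.

Lemma cadlag01_expR z : cadlag01 z -> cadlag01 (fun t => expR (z t)).
Proof.
move=> [zr zl]; split => t t01.
  by apply: (cvg_comp _ expR (zr t t01)); exact: continuous_expR.
have /cvg_ex[l zt] := zl t t01; apply/cvg_ex; exists (expR l).
by apply: (cvg_comp _ expR zt); exact: continuous_expR.
Qed.

Lemma cadlag01_step (b : nat -> R) (n : nat) :
  cadlag01 (fun t => b (Num.truncn (n%:R * t))).
Proof.
have [->|n0] := posnP n.
  apply: unif_continuous_cadlag01 => e e0; exists 1 => // s t _ _ _.
  by rewrite !mul0r subrr normr0 ltW.
have nR0 : 0 < n%:R :> R by rewrite ltr0n.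
apply: cadlag01I => t /andP[t0 t1].
  move=> e e0; pose m := Num.truncn (n%:R * t).
  have /andP[mt tm] : m%:R <= n%:R * t < m.+1%:R.
    by apply: truncn_itv; rewrite mulr_ge0// ltW.
  exists (m.+1%:R / n%:R - t).
    by rewrite subr_gt0 ltr_pdivlMr// mulrC.
  move=> s ts sm.
  have -> : Num.truncn (n%:R * s) = m.
    apply: truncn_def; rewrite (le_trans mt) ?ler_pM2l ?(ltW ts)//=.
    by rewrite mulrC -ltr_pdivlMr//; lra.
  by rewrite subrr normr0 ltW.
pose m := (Num.truncn (n%:R * t)).
have /andP[mt tm] : m%:R <= n%:R * t < m.+1%:R.
  by apply: truncn_itv; rewrite mulr_ge0// ltW.
(* At a grid point the left limit is the value [b m.-1] of the previous cell; otherwise [t] is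
   interior to the [m]-th cell. *)
have [mte|mtn] := eqVneq (m%:R : R) (n%:R * t).
  have m0 : (0 < m)%N by rewrite -(ltr0n R) mte mulr_gt0.
  exists (b m.-1) => e e0; exists (n%:R^-1); first by rewrite invr_gt0.
  move=> s hs st.
  have -> : Num.truncn (n%:R * s) = m.-1.
    apply: truncn_def; rewrite prednK// mte ltr_pM2l// st andbT.
    have -> : m.-1%:R = m%:R - 1 :> R by rewrite -[in RHS](prednK m0) -natr1; ring.
    rewrite mte -(@ler_pM2r _ (n%:R^-1)) ?invr_gt0//.
    rewrite mulrBl mul1r mulrAC mulfV ?gt_eqF// mul1r mulrAC mulfV ?gt_eqF//.
    by rewrite mul1r ltW.
  by rewrite subrr normr0 ltW.
have {}mt : m%:R < n%:R * t by rewrite lt_neqAle mtn mt.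
exists (b m) => e e0; exists (t - m%:R / n%:R).
  by rewrite subr_gt0 ltr_pdivrMr// mulrC.
move=> s hs st.
have -> : Num.truncn (n%:R * s) = m.
  apply: truncn_def; rewrite (le_lt_trans _ tm) ?ler_pM2l// ?(ltW st)// andbT.
  by rewrite mulrC -ler_pdivrMr//; lra.
by rewrite subrr normr0 ltW.
Qed.

Lemma cadlag01_bounded x : cadlag01 x ->
  exists2 K, 0 <= K & forall t, 0 <= t <= 1 -> `|x t| <= K.
Proof.
move=> xc.
pose A a b := exists2 K, 0 <= K & forall t, a <= t <= b -> `|x t| <= K.
apply: (@interval_induction A 0 1 ltr01).
- move=> u v w _ uv vw _ [K K0 xK] [K' K'0 xK'].
  exists (K + K'); first by rewrite addr_ge0.
  move=> t /andP[ut tw]; have [tv|vt] := leP t v.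
    by rewrite (le_trans (xK _ _)) ?ut ?tv//; lra.
  by rewrite (le_trans (xK' _ _)) ?tw ?(ltW vt)//; lra.
- move=> t t01; have [h h0 xh] := cadlag01_right xc t01 ltr01.
  exists h => // v tv vh _; exists (`|x t| + 1); first by rewrite addr_ge0.
  move=> s /andP[ts sv]; have := xh s ts (le_lt_trans sv vh).
  by have := lerB_dist (x s) (x t); lra.
- move=> t t01; have [l xl] := cadlag01_left xc t01.
  have [h h0 xh] := xl 1 ltr01.
  exists h => // u hu ut _; exists (`|x t| + `|l| + 1); first by rewrite !addr_ge0.
  move=> s /andP[us st]; have /orP[/eqP->|{}st] : (s == t) || (s < t).
      by rewrite -le_eqVlt.
    by have := normr_ge0 l; lra.
  have := xh s (lt_le_trans hu us) st.
  by have := lerB_dist (x s) l; have := normr_ge0 (x t); lra.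
Qed.

End cadlag.

(** * Integrals over subintervals of the unit interval *)

Section integral01.
Context {R : realType}.
Implicit Types (f g x y z : R -> R) (a b c e h k l s t u v K : R).

Definition int01 f :=
  (@lebesgue_measure R).-integrable `[0 : R, 1]%classic (EFin \o f).

Definition Rint f a b : R := \int[lebesgue_measure]_(s in `[a, b]) f s.

(** Bounded and measurable on the unit interval: unlike integrability, this is stable under
    products, and it implies [int01]. *)
Definition bmf01 f := measurable_fun `[0 : R, 1]%classic f /\
  exists K, forall t, 0 <= t <= 1 -> `|f t| <= K.

Lemma bmf01_int01 f : bmf01 f -> int01 f.
Proof.
move=> [mf [K fK]]; apply: measurable_bounded_integrable => //.
  by rewrite /= lebesgue_measure_itv/= lte_fin ltr01 -EFinB ltry.
exists K; split; first exact: num_real.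
move=> M KM t /=; rewrite in_itv/= => t01.
exact: le_trans (fK t t01) (ltW KM).
Qed.

Lemma bmf01B f g : bmf01 f -> bmf01 g -> bmf01 (fun s => f s - g s).
Proof.
move=> [mf [K fK]] [mg [K' gK]]; split; first exact: measurable_funB.
exists (K + K') => t t01; rewrite (le_trans (ler_normB _ _))//.
by rewrite lerD// ?fK ?gK.
Qed.

Lemma bmf01M f g : bmf01 f -> bmf01 g -> bmf01 (fun s => f s * g s).
Proof.
move=> [mf [K fK]] [mg [K' gK]]; split; first exact: measurable_funM.
by exists (K * K') => t t01; rewrite normrM ler_pM ?fK ?gK.
Qed.

Lemma bmf01_norm f : bmf01 f -> bmf01 (fun s => `|f s|).
Proof.
move=> [mf [K fK]]; split; first exact: measurableT_comp.
by exists K => t t01; rewrite normr_id fK.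
Qed.

Lemma bmf01_cst k : bmf01 (fun=> k).
Proof. by split => //; exists `|k|. Qed.

Lemma int01_sub f a b : 0 <= a -> b <= 1 -> int01 f ->
  (@lebesgue_measure R).-integrable `[a, b]%classic (EFin \o f).
Proof.
move=> a0 b1; apply: integrableS => //.
move=> t /=; rewrite !in_itv/= => /andP[at_ tb].
by rewrite (le_trans a0 at_) (le_trans tb b1).
Qed.

Lemma int01_norm f : int01 f -> int01 (fun s => `|f s|).
Proof. exact: integrable_norm. Qed.

Lemma Rint_cat f a b c : 0 <= a -> a <= b -> b <= c -> c <= 1 -> int01 f ->
  Rint f a c = Rint f a b + Rint f b c.
Proof.
move=> a0 ab bc c1 fi.
have b0 := le_trans a0 ab.
have := @Rintegral_itvB _ f (BLeft a) (BRight c) b.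
rewrite !bnd_simp => /(_ (int01_sub a0 c1 fi) ab bc).
rewrite Rintegral_itv_obnd_cbnd; last first.
  apply: integrableS (int01_sub b0 c1 fi) => //.
  exact: subset_itv_oc_cc.
by move=> /eqP; rewrite subr_eq addrC => /eqP.
Qed.

Lemma le_Rint f g a b : 0 <= a -> b <= 1 -> int01 f -> int01 g ->
  (forall s, a <= s <= b -> f s <= g s) -> Rint f a b <= Rint g a b.
Proof.
move=> a0 b1 fi gi fg; apply: le_Rintegral => //; try exact: int01_sub.
Qed.

Lemma Rint_cst k a b : a <= b -> Rint (fun=> k) a b = k * (b - a).
Proof.
move=> ab; rewrite /Rint Rintegral_cst//= lebesgue_measure_itv/= lte_fin.
case: ltP => [_|ba]; first by rewrite -EFinB.
by have -> : b = a; [apply/eqP; rewrite eq_le ab ba|rewrite subrr].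
Qed.

Lemma Rint_le_cst f k a b : 0 <= a -> a <= b -> b <= 1 -> int01 f ->
  (forall s, a <= s <= b -> f s <= k) -> Rint f a b <= k * (b - a).
Proof.
move=> a0 ab b1 fi fk; rewrite -Rint_cst//; apply: le_Rint => //.
exact/bmf01_int01/bmf01_cst.
Qed.

Lemma Rint_ge0 f a b : (forall s, a <= s <= b -> 0 <= f s) -> 0 <= Rint f a b.
Proof. by move=> f0; apply: Rintegral_ge0 => s /=; rewrite in_itv/=; exact: f0. Qed.

Lemma Rint_norm f a b : 0 <= a -> b <= 1 -> int01 f ->
  `|Rint f a b| <= Rint (fun s => `|f s|) a b.
Proof. by move=> a0 b1 fi; apply: le_normr_Rintegral => //; exact: int01_sub. Qed.

Lemma Rint_norm_le_cst f k a b : 0 <= a -> a <= b -> b <= 1 -> int01 f ->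
  (forall s, a <= s <= b -> `|f s| <= k) -> `|Rint f a b| <= k * (b - a).
Proof.
move=> a0 ab b1 fi fk; apply: le_trans (Rint_norm a0 b1 fi) _.
by apply: Rint_le_cst => //; exact: int01_norm.
Qed.

Lemma Rint_sub f g a b : 0 <= a -> b <= 1 -> int01 f -> int01 g ->
  Rint (fun s => f s - g s) a b = Rint f a b - Rint g a b.
Proof. by move=> a0 b1 fi gi; apply: RintegralB => //; exact: int01_sub. Qed.

Lemma Rint_Zl f k a b : 0 <= a -> b <= 1 -> int01 f ->
  Rint (fun s => k * f s) a b = k * Rint f a b.
Proof. by move=> a0 b1 fi; apply: RintegralZl => //; exact: int01_sub. Qed.

Lemma Rint_subset f a b c d : 0 <= a -> a <= b -> b <= c -> c <= d -> d <= 1 ->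
  int01 f -> (forall s, 0 <= s <= 1 -> 0 <= f s) -> Rint f b c <= Rint f a d.
Proof.
move=> a0 ab bc cd d1 fi f0.
rewrite (@Rint_cat f a b d)//; [|lra].
rewrite (@Rint_cat f b c d)//; [|lra].
have : 0 <= Rint f a b by apply: Rint_ge0 => s ?; apply: f0; apply/andP; lra.
have : 0 <= Rint f c d by apply: Rint_ge0 => s ?; apply: f0; apply/andP; lra.
lra.
Qed.

(** Interval induction glues two-valued pieces into a measurable function uniformly [e]-close to
    [x]; then [x] is a pointwise limit of such functions. *)
Lemma cadlag01_measurable x : cadlag01 x -> measurable_fun `[0 : R, 1]%classic x.
Proof.
move=> xc.
have approx (e : R) : 0 < e -> exists2 g : R -> R, measurable_fun setT g &
    forall s, 0 <= s <= 1 -> `|x s - g s| <= e.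
  move=> e0.
  pose A a b := exists2 g : R -> R, measurable_fun setT g &
    forall s, a <= s <= b -> `|x s - g s| <= e.
  apply: (@interval_induction _ A 0 1 ltr01).
  - move=> u v w _ uv vw _ [g mg xg] [g' mg' xg'].
    exists (fun s => if s <= v then g s else g' s).
      apply: measurable_fun_ifT => //.
      exact: measurable_fun_ler.
    move=> s /andP[us S_at] /=; case: (leP s v) => [sv|vs]; [apply: xg|apply: xg'].
      by rewrite us sv.
    by rewrite (ltW vs) S_at.
  - move=> t t01; have [h h0 xh] := cadlag01_right xc t01 e0.
    exists h => // v tv vh _; exists (cst (x t)) => // s /andP[ts sv].
    by apply: xh => //; exact: le_lt_trans vh.
  - move=> t t01; have [l xl] := cadlag01_left xc t01.
    have [h h0 xh] := xl e e0.
    exists h => // u hu ut _; exists (fun s => if s < t then l else x t).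
      apply: measurable_fun_ifT => //.
      exact: measurable_fun_ltr.
    move=> s /andP[us st] /=; case: (ltP s t) => [{}st|ts].
      by apply: xh => //; exact: lt_le_trans hu us.
    have -> : s = t by apply/eqP; rewrite eq_le st ts.
    by rewrite subrr normr0 ltW.
have {}approx (k : nat) : {g : R -> R | measurable_fun setT g &
    forall s, 0 <= s <= 1 -> `|x s - g s| <= k.+1%:R^-1}.
  by apply/cid2/approx; rewrite invr_gt0.
apply: (@measurable_fun_cvg _ _ _ _ (fun m : nat => s2val (approx m))).
  move=> k; case: (approx k) => g mg /= _.
  exact: measurable_funTS.
move=> t /=; rewrite in_itv/= => t01.
apply/cvgrPdist_le => e e0.
near=> k; case: (approx k) => g mg /= /(_ t t01)/le_trans; apply.
by apply/ltW; near: k; exact: (near_infty_natSinv_lt (PosNum e0)).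
Unshelve. all: by end_near. Qed.

Lemma cadlag01_bmf01 x : cadlag01 x -> bmf01 x.
Proof.
move=> xc; split; first exact: cadlag01_measurable.
by have [K _ xK] := cadlag01_bounded xc; exists K.
Qed.

Lemma Rint_le_split f k k' a b c : 0 <= a -> a <= b -> b <= c -> c <= 1 ->
  int01 f -> (forall s, a <= s <= b -> f s <= k) ->
  (forall s, b <= s <= c -> f s <= k') ->
  Rint f a c <= k * (b - a) + k' * (c - b).
Proof.
move=> a0 ab bc c1 fi fk fk'; rewrite (Rint_cat a0 ab bc c1 fi) lerD//.
  by apply: Rint_le_cst => //; exact: le_trans c1.
by apply: Rint_le_cst => //; exact: le_trans ab.
Qed.

(** By the intermediate value theorem the time change is onto, so every [s] is some [lam u]. The
    later estimates need only this form, in which the time change no longer appears. *)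
Lemma skorokhod_lt_inv x y e : skorokhod_lt x y e -> exists2 c, c < e &
  forall s, 0 <= s <= 1 -> exists2 u, 0 <= u <= 1 &
    `|s - u| <= c /\ `|x u - y s| <= c.
Proof.
move=> [lam [[lc [l0 [l1 _]]] [c [ce lamc]]]]; exists c => // s s01.
have [|u] := @IVT _ lam 0 1 s ler01 lc.
  by rewrite l0 l1 min_l ?max_r.
rewrite in_itv/= => u01 us; exists u => //; rewrite -us.
exact: lamc.
Qed.

Lemma skorokhod_lt_uniform x y c e : 0 <= c -> c < e ->
  (forall t, 0 <= t <= 1 -> `|x t - y t| <= c) -> skorokhod_lt x y e.
Proof.
move=> c0 ce xyc; exists id; split; last first.
  by exists c; split => // t t01; rewrite subrr normr0 c0 xyc.
split; last by do 2 split => //.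
by apply: continuous_subspaceT => t; exact: cvg_id.
Qed.

(* Off a [c]-neighbourhood of finitely many points the time change moves [x] by
   less than [e/2]; on that neighbourhood only boundedness of [x] is used. *)
Lemma skorokhod_L1_continuous x e : cadlag01 x -> 0 < e -> exists2 h, 0 < h &
  forall y, cadlag01 y -> skorokhod_lt x y h ->
    Rint (fun s => `|x s - y s|) 0 1 <= e.
Proof.
move=> xc e0; have [K K0 xK] := cadlag01_bounded xc.
pose near_ y c := forall s, 0 <= s <= 1 -> exists2 u, 0 <= u <= 1 &
    `|s - u| <= c /\ `|x u - y s| <= c.
(* A bound proportional to the length is additive under concatenation, as [interval_induction]
   requires. *)
pose A a b := exists2 h, 0 < h & forall y c, cadlag01 y -> c < h -> near_ y c ->
    Rint (fun s => `|x s - y s|) a b <= e * (b - a).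
have xyi y : cadlag01 y -> int01 (fun s => `|x s - y s|).
  by move=> yc; apply/bmf01_int01/bmf01_norm/bmf01B; exact: cadlag01_bmf01.
have rough y c s : near_ y c -> c <= 1 -> 0 <= s <= 1 -> `|x s - y s| <= 2 * K + 1.
  move=> yc c1 s01; have [u u01 [_ xuc]] := yc s s01.
  have -> : x s - y s = x s - x u + (x u - y s) by ring.
  have := ler_normD (x s - x u) (x u - y s).
  by have := ler_normB (x s) (x u); have := xK _ s01; have := xK _ u01; lra.
have fine_ y c l s u : `|x u - y s| <= c -> c <= e / 4 -> `|x s - l| <= e / 4 ->
    `|x u - l| <= e / 4 -> `|x s - y s| <= 3 / 4 * e.
  move=> xuc ce xs xu.
  have -> : x s - y s = x s - l - (x u - l) + (x u - y s) by ring.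
  have := ler_normD (x s - l - (x u - l)) (x u - y s).
  by have := ler_normB (x s - l) (x u - l); lra.
have e4 : 0 < e / 4 by rewrite divr_gt0.
have K2 : 0 < 2 * K + 1 by lra.
have width d : 0 < d -> 0 < e / 4 * d / (2 * K + 1).
  by move=> d0; rewrite divr_gt0// mulr_gt0.
have [h h0 Ah] : A 0 1; last first.
  exists h => // y yc /skorokhod_lt_inv[c ch xyc].
  by have := Ah y c yc ch xyc; rewrite subr0 mulr1.
apply: (@interval_induction _ A 0 1 ltr01).
- move=> u v w u0 uv vw w1 [h h0 Ah] [h' h'0 Ah'].
  exists (Num.min h h'); first by rewrite lt_min h0.
  move=> y c yc; rewrite lt_min => /andP[ch ch'] xyc.
  rewrite (@Rint_cat _ u v w)//; [|exact: ltW|exact: ltW|exact: xyi].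
  have := Ah y c yc ch xyc; have := Ah' y c yc ch' xyc; lra.
- move=> t t01; have /andP[t0 t1] := t01.
  have [h h0 xh] := cadlag01_right xc t01 e4.
  exists h => // v tv vh v1.
  (* The last entry keeps the contribution of the strip of width [d] next to [t] below
     [e / 4 * (v - t)]. Beyond the strip, a shift by [c < d] stays between [t] and [t + h], where
     [x] is within [e / 4] of [x t]. *)
  pose d := Num.min (Num.min 1 (e / 4)) (Num.min (Num.min (t + h - v) (v - t))
    (e / 4 * (v - t) / (2 * K + 1))).
  have d0 : 0 < d.
    by rewrite !lt_min ltr01 e4 width/=; lra.
  have dE : d <= d by [].
  move: dE; rewrite {2}/d !le_min => /andP[/andP[d1 de] /andP[/andP[dh dv] dw]].
  exists d => // y c yc cd xyc.
  apply: (@le_trans _ _ ((2 * K + 1) * (t + d - t) + 3 / 4 * e * (v - (t + d)))).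
    apply: Rint_le_split => //; [lra|lra|exact: xyi| |].
      by move=> s s01; apply: (rough y c) => //; lra.
    move=> s /andP[ds sv].
    have s01 : 0 <= s <= 1 by lra.
    have [u u01 [suc xuc]] := xyc s s01.
    move: suc; rewrite ler_distl => /andP[su us].
    by apply: (fine_ y c (x t) s u) => //; [lra|apply: xh; lra|apply: xh; lra].
  move: dw; rewrite ler_pdivlMr//.
  have : 0 <= e * d by rewrite ltW// mulr_gt0.
  lra.
- move=> t t01; have /andP[t0 t1] := t01.
  have [l xl] := cadlag01_left xc t01; have [h h0 xh] := xl _ e4.
  exists h => // u hu ut u0.
  pose d := Num.min (Num.min 1 (e / 4)) (Num.min (Num.min (u - (t - h)) (t - u))
    (e / 4 * (t - u) / (2 * K + 1))).
  have d0 : 0 < d.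
    by rewrite !lt_min ltr01 e4 width/=; lra.
  have dE : d <= d by [].
  move: dE; rewrite {2}/d !le_min => /andP[/andP[d1 de] /andP[/andP[dh dv] dw]].
  exists d => // y c yc cd xyc.
  apply: (@le_trans _ _ (3 / 4 * e * (t - d - u) + (2 * K + 1) * (t - (t - d)))).
    apply: Rint_le_split => //; [lra|lra|exact: xyi| |].
      move=> s /andP[us sd].
      have s01 : 0 <= s <= 1 by lra.
      have [v v01 [suc xuc]] := xyc s s01.
      move: suc; rewrite ler_distl => /andP[su us'].
      by apply: (fine_ y c l s v) => //; [lra|apply: xh; lra|apply: xh; lra].
    by move=> s s01; apply: (rough y c) => //; lra.
  move: dw; rewrite ler_pdivlMr//.
  have : 0 <= e * d by rewrite ltW// mulr_gt0.
  lra.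
Qed.

End integral01.

(** * Measurability of Skorokhod-continuous functionals *)

Section uniform_paths.
Context {R : realType}.
Implicit Types (f g x y z : R -> R) (a b c e h l s t u v K : R).

Lemma within_continuous_dist x : {within `[0, +oo[, continuous x} ->
  forall t, 0 <= t -> forall e, 0 < e -> exists2 h, 0 < h &
    forall s, 0 <= s -> `|s - t| < h -> `|x s - x t| <= e.
Proof.
move=> /continuous_within_itvcyP[xc x0] t; rewrite le_eqVlt => /predU1P[<-|t0] e e0.
  move/cvgrPdist_le : x0 => /(_ e e0); rewrite near_withinE => /nbhs_ballP[h /= h0 xh].
  exists h => // s; rewrite le_eqVlt => /predU1P[<- _|s0 sh].
    by rewrite subrr normr0 ltW.
  by rewrite distrC; apply: xh => //; rewrite /ball/= distrC.
have /xc : t \in `]0, +oo[ by rewrite in_itv/= t0.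
move=> /cvgrPdist_le/(_ e e0)/nbhs_ballP[h /= h0 xh].
exists h => // s _ sh; rewrite distrC; apply: xh => //.
by rewrite /ball/= distrC.
Qed.

(** Heine-Cantor by interval induction; a pair straddling the junction [v] is compared through
    [x v], at [e / 2] for each half. *)
Lemma within_continuous_unif x : {within `[0, +oo[, continuous x} ->
  forall e, 0 < e -> exists2 h, 0 < h & forall s t,
    0 <= s <= 1 -> 0 <= t <= 1 -> `|s - t| < h -> `|x s - x t| <= e.
Proof.
move=> /within_continuous_dist xc e e0.
have e2 : 0 < e / 2 by rewrite divr_gt0.
pose A a b := exists2 h, 0 < h & forall s t,
    a <= s <= b -> a <= t <= b -> `|s - t| < h -> `|x s - x t| <= e.
have far (p q r : R) : `|x p - x r| <= e / 2 -> `|x q - x r| <= e / 2 ->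
    `|x p - x q| <= e.
  move=> pr qr; have -> : x p - x q = (x p - x r) - (x q - x r) by ring.
  by have := ler_normB (x p - x r) (x q - x r); lra.
apply: (@interval_induction _ A 0 1 ltr01).
- move=> u v w u0 uv vw w1 [h h0 xh] [h' h'0 xh'].
  have [k k0 xk] := xc v (le_trans u0 (ltW uv)) _ e2.
  exists (Num.min k (Num.min h h')); first by rewrite !lt_min k0 h0.
  have cross s t : u <= s <= w -> u <= t <= w -> s <= v -> v <= t ->
      `|s - t| < k -> `|x s - x t| <= e.
    move=> /andP[us S_at] /andP[ut tw] sv vt; rewrite distrC ger0_norm; last lra.
    move=> stk; apply: (far s t v).
      by apply: xk; [lra|rewrite distrC ger0_norm; lra].
    by apply: xk; [lra|rewrite ger0_norm; lra].
  move=> s t /[dup] suw /andP[us S_at] /[dup] tuw /andP[ut tw].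
  rewrite !lt_min => /and3P[stk sth sth'].
  have [sv|vs] := leP s v; have [tv|vt] := leP t v.
  + by apply: xh => //; apply/andP.
  + by apply: cross => //; exact: ltW.
  + by rewrite distrC; apply: cross => //; [exact: ltW|rewrite distrC].
  + by apply: xh' => //; apply/andP; split => //; exact: ltW.
- move=> t /andP[t0 t1]; have [h h0 xh] := xc t t0 _ e2.
  exists h => // v tv vh v1; exists h => // p q /andP[tp pv] /andP[tq qv] _.
  by apply: (far p q t); apply: xh; rewrite ?ger0_norm; lra.
- move=> t /andP[t0 t1]; have [h h0 xh] := xc t (ltW t0) _ e2.
  exists h => // u hu ut u0; exists h => // p q /andP[up pt] /andP[uq qt] _.
  by apply: (far p q t); apply: xh; rewrite 1?distrC ?ger0_norm; lra.
Qed.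

Lemma truncn_div_itv (m : nat) t : (0 < m)%N -> 0 <= t ->
  (Num.truncn (m%:R * t))%:R / m%:R <= t < (Num.truncn (m%:R * t))%:R / m%:R + m%:R^-1.
Proof.
move=> m0 t0; have mR : 0 < m%:R :> R by rewrite ltr0n.
have /andP[h1 h2] := truncn_itv (mulr_ge0 (ltW mR) t0).
rewrite ler_pdivrMr// [t * _]mulrC h1/= -[X in _ + X]mul1r -mulrDl ltr_pdivlMr//.
by rewrite natr1 [t * _]mulrC.
Qed.

Lemma truncn_le_mul (m : nat) t : t <= 1 -> (Num.truncn (m%:R * t) <= m)%N.
Proof.
move=> t1; rewrite truncn_le_nat (@le_lt_trans _ _ (m%:R))//.
  by rewrite -[leRHS]mulr1 ler_wpM2l.
by rewrite ltr_nat.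
Qed.
End uniform_paths.

Section measurable_functional.
Context {R : realType} {d : measure_display} {Omega : measurableType d}.

Lemma measurable_countable_comp (T : countType) (h : Omega -> T) (g : T -> R) :
  (forall c, measurable (h @^-1` [set c])) ->
  measurable_fun [set: Omega] (g \o h).
Proof.
move=> mh _ B mB; rewrite setTI.
rewrite (_ : _ @^-1` B = \bigcup_(n in [set n : nat |
    if unpickle n is Some c then B (g c) else False])
    (if unpickle n is Some c then h @^-1` [set c] else set0)); last first.
  apply/seteqP; split => [w /= Bw|w [n /=]].
    by exists (pickle (h w)); rewrite /= pickleK.
  by case: unpickle => [c|//] Bc /= ->.
apply: bigcup_measurable => n _.
by case: unpickle => [c|]; [exact: mh|exact: measurable0].
Qed.

Lemma measurable_floor_fiber (X : Omega -> R) (k : int) :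
  measurable_fun setT X -> measurable [set w | Num.floor (X w) = k].
Proof.
move=> mX.
rewrite (_ : [set _ | _] = setT `&` X @^-1` `[k%:~R, (k + 1)%:~R[%classic); last first.
  rewrite setTI; apply/seteqP; split => w /=; rewrite in_itv/=.
    by move=> <-; exact: floor_itv.
  by move=> /floor_def.
exact: mX.
Qed.

(* [X] is approximated uniformly by countably-valued step paths: sampled on the
   grid [i / mm j] and rounded down to multiples of [1 / j.+1]. *)
Lemma measurable_skorokhod_comp (X : Omega -> R -> R) (f : (R -> R) -> R)
    (mm : nat -> nat) :
  skorokhod_continuous f -> (forall w, cadlag01 (X w)) ->
  (forall t, 0 <= t <= 1 -> measurable_fun [set: Omega] (X ^~ t)) ->
  (forall w (e : R), 0 < e -> exists N : nat, forall j, (N <= j)%N -> forall t, 0 <= t <= 1 ->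
    `|X w t - X w ((Num.truncn ((mm j)%:R * t))%:R / (mm j)%:R)| <= e) ->
  measurable_fun [set: Omega] (fun w => f (X w)).
Proof.
move=> fc Xc mX Xapp.
pose h j w := [ffun i : 'I_(mm j).+1 =>
  Num.floor (j.+1%:R * X w (i%:R / (mm j)%:R))].
pose Z j (c : {ffun 'I_(mm j).+1 -> int}) (t : R) : R :=
  (c (inord (Num.truncn ((mm j)%:R * t))))%:~R / j.+1%:R.
have Zc j c : cadlag01 (Z j c).
  exact: (cadlag01_step (fun i => (c (inord i))%:~R / j.+1%:R) (mm j)).
(* [h j] takes values in a countable type and has measurable fibres, so anything composed after it
   is measurable. Continuity of [f] serves only for the pointwise limit. *)
apply: (@measurable_fun_cvg _ _ _ _ (fun j => (f \o Z j) \o h j)).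
  move=> j; apply: measurable_countable_comp => c.
  rewrite (_ : _ @^-1` _ = \bigcap_(i in [set: 'I_(mm j).+1])
      [set w | Num.floor (j.+1%:R * X w (i%:R / (mm j)%:R)) = c i]); last first.
    apply/seteqP; split => w /=.
      by move=> <- i _ /=; rewrite ffunE.
    by move=> hw; apply/ffunP => i; rewrite ffunE; exact: hw.
  apply: fin_bigcap_measurable => [|i _]; first exact: finite_finset.
  apply: measurable_floor_fiber; apply: measurable_funM => //.
  apply: mX; rewrite divr_ge0//=.
  (* For [mm j = 0], division by zero gives 0 and the grid is the single point 0. *)
  have [m0|m0] := posnP (mm j); first by rewrite [X in X%:R^-1]m0 invr0 mulr0.
  by rewrite ler_pdivrMr ?ltr0n// mul1r ler_nat -ltnS.
move=> w _; apply/cvgrPdist_lt => e e0.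
have [dl dl0 fd] := fc _ (Xc w) e e0.
have dl4 : 0 < dl / 4 by rewrite divr_gt0.
have [N XN] := Xapp w _ dl4.
near=> j; apply: fd => //.
apply: (@skorokhod_lt_uniform _ _ _ (dl / 2)); [lra|lra|].
move=> t t01; rewrite /Z ffunE.
set m := mm j; set i := Num.truncn (m%:R * t).
have im : (i < m.+1)%N by rewrite ltnS truncn_le_mul//; case/andP: t01.
rewrite inordK//; set v := X w (i%:R / m%:R).
have jR : 0 < j.+1%:R :> R by rewrite ltr0n.
have /andP[v1 v2] := floor_itv (j.+1%:R * v).
set k := Num.floor _ in v1 v2 *.
have dv : `|v - k%:~R / j.+1%:R| <= j.+1%:R^-1.
  rewrite ger0_norm.
    rewrite lerBlDr addrC -[X in _ + X]mul1r -mulrDl ler_pdivlMr// mulrC.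
    by rewrite ltW//; move: v2; rewrite intrD.
  by rewrite subr_ge0 ler_pdivrMr// mulrC.
have -> : X w t - k%:~R / j.+1%:R = (X w t - v) + (v - k%:~R / j.+1%:R) by ring.
apply: le_trans (ler_normD _ _) _.
have jN : (N <= j)%N by near: j; exact: nbhs_infty_ge.
have Xv : `|X w t - v| <= dl / 4 := XN j jN t t01.
have jd : j.+1%:R^-1 <= dl / 4.
  by apply/ltW; near: j; exact: (near_infty_natSinv_lt (PosNum dl4)).
apply: le_trans (lerD Xv dv) _; rewrite (_ : dl / 2 = dl / 4 + dl / 4) ?lerD2l//.
by field.
Unshelve. all: by end_near. Qed.

Lemma measurable_functional_continuous (X : Omega -> R -> R) (f : (R -> R) -> R) :
  skorokhod_continuous f -> (forall w, {within `[0, +oo[, continuous (X w)}) ->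
  (forall t, 0 <= t <= 1 -> measurable_fun [set: Omega] (X ^~ t)) ->
  measurable_fun [set: Omega] (fun w => f (X w)).
Proof.
(* Here [S] is the successor on [nat]: the [j]-th grid has mesh [1 / j.+1]. *)
move=> fc Xc mX; apply: (@measurable_skorokhod_comp _ _ S) => //.
  by move=> w; apply/unif_continuous_cadlag01/within_continuous_unif.
move=> w e /(within_continuous_unif (Xc w))[h h0 Xh].
have [N _ NP] : \forall j \near \oo, j.+1%:R^-1 < h.
  exact: (near_infty_natSinv_lt (PosNum h0)).
exists N => j Nj t /andP[t0 t1].
have /andP[d1 d2] := truncn_div_itv (ltn0Sn j) t0.
have t'0 : 0 <= (Num.truncn (j.+1%:R * t))%:R / j.+1%:R :> R by rewrite divr_ge0.
have /= jh := NP j Nj.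
move: d1 d2 t'0 jh; set q := ((Num.truncn _)%:R / _); set p := j.+1%:R^-1.
move=> d1 d2 q0 ph; rewrite -/q.
move: q p d1 d2 q0 ph => q p d1 d2 q0 ph.
by apply: Xh; [apply/andP; lra|apply/andP; lra|rewrite ger0_norm; lra].
Qed.

Lemma measurable_functional_step (b : nat -> Omega -> R) (n : nat) (f : (R -> R) -> R) :
  skorokhod_continuous f -> (forall k, measurable_fun [set: Omega] (b k)) ->
  measurable_fun [set: Omega] (fun w => f (fun t => b (Num.truncn (n%:R * t)) w)).
Proof.
(* A constant grid suffices: a step path is recovered exactly from its values at the points
   [i / n]. *)
move=> fc mb; apply: (@measurable_skorokhod_comp _ _ (fun=> n)) => //.
  by move=> w; exact: (cadlag01_step (fun k => b k w)).
move=> w e e0; exists 0%N => _ _ t /andP[t0 t1].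
have [->|n0] := posnP n; first by rewrite !mul0r subrr normr0 ltW.
by rewrite [n%:R * (_ / _)]mulrC divfK ?pnatr_eq0 -?lt0n// natrK subrr normr0 ltW.
Qed.

End measurable_functional.

(** * Lipschitz minorants by inf-convolution *)

Section inf_convolution.
Context {R : realType}.
Implicit Types (x y z : R -> R) (c e h K : R).

Definition unif_le z y c := forall t, 0 <= t <= 1 -> `|z t - y t| <= c.

Lemma unif_leC z y c : unif_le z y c -> unif_le y z c.
Proof. by move=> zy t t01; rewrite distrC zy. Qed.

Definition unif_continuous_at (Phi : (R -> R) -> R) z :=
  forall e, 0 < e -> exists2 h, 0 < h &
    forall y, cadlag01 y -> unif_le z y h -> `|Phi z - Phi y| <= e.

(* Lipschitz minorant of [Phi] for the uniform distance on cadlag paths. *)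
Definition infconv (Phi : (R -> R) -> R) L z : R :=
  inf [set r | exists y c, [/\ cadlag01 y, 0 <= c, unif_le z y c & r = Phi y + L * c]].

Variables (Phi : (R -> R) -> R) (M : R).
Hypothesis PhiM : forall x, `|Phi x| <= M.

Let lbPhi L z : 0 <= L -> lbound [set r | exists y c,
  [/\ cadlag01 y, 0 <= c, unif_le z y c & r = Phi y + L * c]] (- M).
Proof.
move=> L0 r [y [c [_ c0 _ ->]]].
have := PhiM y; rewrite ler_norml => /andP[].
by have := mulr_ge0 L0 c0; lra.
Qed.

Lemma infconv_le L z y c : 0 <= L -> cadlag01 y -> 0 <= c -> unif_le z y c ->
  infconv Phi L z <= Phi y + L * c.
Proof.
move=> L0 yc c0 zy; apply: ge_inf; first by exists (- M); exact: lbPhi.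
by exists y, c.
Qed.

Lemma infconv_le_self L z : 0 <= L -> cadlag01 z -> infconv Phi L z <= Phi z.
Proof.
move=> L0 zc; rewrite -[leRHS]addr0 -(mulr0 L); apply: infconv_le => //.
by move=> t _; rewrite subrr normr0.
Qed.

Lemma infconv_ge L z r : cadlag01 z ->
  (forall y c, cadlag01 y -> 0 <= c -> unif_le z y c -> r <= Phi y + L * c) ->
  r <= infconv Phi L z.
Proof.
move=> zc rle; apply: lb_le_inf.
  exists (Phi z + L * 0), z, 0; split => // t _.
  by rewrite subrr normr0.
by move=> _ [y [c [yc c0 zy ->]]]; exact: rle.
Qed.

Lemma infconv_bound L z : 0 <= L -> cadlag01 z -> `|infconv Phi L z| <= M.
Proof.
move=> L0 zc; rewrite ler_norml; apply/andP; split.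
  apply: infconv_ge => // y c yc c0 zy; apply: (@lbPhi L z) => //.
  by exists y, c.
apply: le_trans (infconv_le_self L0 zc) _.
by have := PhiM z; rewrite ler_norml => /andP[].
Qed.

Lemma infconv_lipschitz L z z' c : 0 <= L -> cadlag01 z -> cadlag01 z' -> 0 <= c ->
  unif_le z z' c -> infconv Phi L z <= infconv Phi L z' + L * c.
Proof.
move=> L0 zc z'c c0 zz'; rewrite -lerBlDr.
apply: infconv_ge => // y c' yc c'0 z'y.
rewrite lerBlDr -addrA -mulrDr; apply: infconv_le => //; first exact: addr_ge0.
move=> t t01; have -> : z t - y t = (z t - z' t) + (z' t - y t) by ring.
by apply: le_trans (ler_normD _ _) _; rewrite addrC lerD ?zz' ?z'y.
Qed.

(** From above, the minorant is at most [Phi (zz m)], which is close to [Phi z]. From below,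
    competitors within [h] of [z] have nearly the value [Phi z], those farther away pay a penalty of
    at least [2 * M], and moving from [z] to [zz m] costs [L m * c m]. Hence the condition on the
    product, which couples Lipschitz constant and cut-off. *)
Lemma infconv_cvg (L c : nat -> R) (zz : nat -> R -> R) z :
  unif_continuous_at Phi z -> cadlag01 z -> (forall m, cadlag01 (zz m)) ->
  (forall m, 0 <= L m) -> (forall m, 0 <= c m) ->
  (forall m, unif_le z (zz m) (c m)) ->
  L @ \oo --> +oo -> c @ \oo --> 0 -> (fun m => L m * c m) @ \oo --> 0 ->
  (fun m => infconv Phi (L m) (zz m)) @ \oo --> Phi z.
Proof.
move=> Phic zc zzc L0 c0 zzz Loo c00 Lc0.
apply/cvgrPdist_le => e e0.
have e2 : 0 < e / 2 by rewrite divr_gt0.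
have [h h0 Phih] := Phic _ e2.
near=> m.
have Lch : L m * c m <= e / 2.
  near: m; move/cvgr0Pnorm_le : Lc0 => /(_ _ e2); apply: filterS => m.
  by apply: le_trans; exact: ler_norm.
have ch : c m <= h.
  near: m; move/cvgr0Pnorm_le : c00 => /(_ _ h0); apply: filterS => m.
  by apply: le_trans; exact: ler_norm.
have Lh : 2 * M / h <= L m.
  by near: m; move/cvgryPge : Loo; exact.
have M2 : 2 * M <= L m * h by rewrite -ler_pdivrMr.
rewrite ler_norml; apply/andP; split; last first.
  have low : Phi z - e / 2 <= infconv Phi (L m) z.
    apply: infconv_ge => // y r yc r0 zy.
    have [rh|hr] := leP r h.
      have /(Phih y yc) : unif_le z y h by move=> t t01; exact: le_trans (zy t t01) rh.
      by rewrite ler_norml => /andP[]; have := mulr_ge0 (L0 m) r0; lra.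
    have := PhiM y; rewrite ler_norml => /andP[y1 y2].
    have := PhiM z; rewrite ler_norml => /andP[z1 z2].
    have : L m * h <= L m * r by rewrite ler_wpM2l// ltW.
    lra.
  have := infconv_lipschitz (L0 m) zc (zzc m) (c0 m) (zzz m).
  lra.
have up := infconv_le_self (L0 m) (zzc m).
have /(Phih _ (zzc m)) : unif_le z (zz m) h by move=> t t01; exact: le_trans (zzz m t t01) ch.
by rewrite ler_norml => /andP[]; lra.
Unshelve. all: by end_near. Qed.

End inf_convolution.

(** * Cut-off integrals *)

Section weights.
Context {R : realType}.
Implicit Types (f g w x y z : R -> R) (a b c e h l s t u v K : R).

Definition cutoff w e s := if s < e then 0 else w s.

(** The value 0 at 0 makes the cut-off weights increase to [w] at every point of the half-line, 0
    included. *)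
Definition decreasing_weight w := [/\ forall s, 0 <= w s, w 0 = 0 &
  forall s t, 0 < s -> s <= t -> w t <= w s].

Lemma cutoff_ge0 w e s : decreasing_weight w -> 0 <= cutoff w e s.
Proof. by move=> [w0 _ _]; rewrite /cutoff; case: ifP. Qed.

Lemma cutoff_le w e s : decreasing_weight w -> 0 < e -> cutoff w e s <= w e.
Proof.
by move=> [w0 _ wd] e0; rewrite /cutoff; case: ltP => // es; exact: wd.
Qed.

Lemma cutoff_le_weight w e s : decreasing_weight w -> cutoff w e s <= w s.
Proof. by move=> [w0 _ wd]; rewrite /cutoff; case: ltP. Qed.

Lemma bmf01_cutoff w e : decreasing_weight w -> 0 < e -> bmf01 (cutoff w e).
Proof.
move=> ww e0; have [w0 _ wd] := ww; split; last first.
  by exists (w e) => t _; rewrite ger0_norm ?cutoff_ge0 ?cutoff_le.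
(* Freezing the weight below [e] gives a function monotone on the whole line, hence measurable. *)
have -> : cutoff w e = fun s => if s < e then 0 else w (Num.max e s).
  by apply/funext => s; rewrite /cutoff; case: ltP.
apply: measurable_funTS; apply: measurable_fun_ifT => //.
  exact: measurable_fun_ltr.
apply: nonincreasing_measurable => // s t st.
apply: wd; first by rewrite lt_max e0.
by rewrite ge_max le_max lexx/= le_max st orbT.
Qed.

Lemma cutoff_cvg w s : decreasing_weight w -> 0 <= s ->
  (fun k : nat => cutoff w k.+1%:R^-1 s) @ \oo --> w s.
Proof.
move=> [w0 wz wd]; rewrite le_eqVlt => /predU1P[<-|s0].
  rewrite wz; apply: cvg_near_cst; apply: nearW => k.
  by rewrite /cutoff invr_gt0 ltr0n.
apply: cvg_near_cst; near=> k; rewrite /cutoff ltNge ltW//.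
near: k; exact: (near_infty_natSinv_lt (PosNum s0)).
Unshelve. all: by end_near. Qed.

Lemma cutoff_nd w s : decreasing_weight w ->
  {homo (fun k : nat => cutoff w k.+1%:R^-1 s) : m n / (m <= n)%N >-> m <= n}.
Proof.
move=> [w0 wz wd] m n mn; rewrite /cutoff; case: ltP => [_|ms].
  by case: ifP.
case: ltP => // sn; have : n.+1%:R^-1 <= m.+1%:R^-1 :> R.
  by rewrite lef_pV2 ?posrE// ler_nat.
by move=> /(lt_le_trans sn); rewrite ltNge ms.
Qed.

Lemma measurable_weight w : decreasing_weight w ->
  measurable_fun `[0 : R, 1]%classic w.
Proof.
move=> ww; apply: (@measurable_fun_cvg _ _ _ _ (fun m : nat => cutoff w m.+1%:R^-1)).
  by move=> m; apply: (bmf01_cutoff ww _).1; rewrite invr_gt0.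
by move=> s /=; rewrite in_itv/= => /andP[s0 _]; exact: cutoff_cvg.
Qed.

(** Fourth root: what is gained when [s^(-5/4)] is traded for [1 / s]. *)
Definition qrt s := Num.sqrt (Num.sqrt s).

Lemma qrt_ge0 s : 0 <= qrt s. Proof. exact: sqrtr_ge0. Qed.

Lemma qrt_gt0 s : 0 < s -> 0 < qrt s.
Proof. by move=> s0; rewrite /qrt !sqrtr_gt0. Qed.

Lemma le_qrt s t : s <= t -> qrt s <= qrt t.
Proof. by move=> st; rewrite /qrt !ler_wsqrtr. Qed.

Lemma qrt1 : qrt 1 = 1. Proof. by rewrite /qrt !sqrtr1. Qed.

Lemma qrtX4 s : 0 <= s -> qrt s ^+ 4 = s.
Proof. by move=> s0; rewrite /qrt -[4%N]/(2 * 2)%N exprM !sqr_sqrtr ?sqrtr_ge0. Qed.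

Lemma qrtK s : 0 <= s -> qrt (s ^+ 4) = s.
Proof.
move=> s0; rewrite /qrt -[4%N]/(2 * 2)%N exprM sqrtr_sqr ger0_norm ?exprn_ge0//.
by rewrite sqrtr_sqr ger0_norm.
Qed.

Lemma qrtM s t : 0 <= s -> qrt (s * t) = qrt s * qrt t.
Proof. by move=> s0; rewrite /qrt sqrtrM// sqrtrM// sqrtr_ge0. Qed.

Lemma qrtV s : 0 <= s -> qrt s^-1 = (qrt s)^-1.
Proof. by move=> s0; rewrite /qrt sqrtrV// sqrtrV// sqrtr_ge0. Qed.

(** Zero on negative numbers and, as [0^-1 = 0], also at 0, so that it is a [decreasing_weight]. *)
Definition inv_weight s := if s < 0 then 0 else s^-1.
(* [s ^ (-5/4)], slightly heavier than [1 / s], so that the tails of [x s / s] at 0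
   decrease at the rate [qrt e]. *)
Definition tail_weight s := if s < 0 then 0 else (s * qrt s)^-1.

Lemma decreasing_inv_weight : decreasing_weight inv_weight.
Proof.
split=> [s| |s t s0 st]; rewrite /inv_weight.
- by case: ltP => // s0; rewrite invr_ge0.
- by rewrite ltxx invr0.
- rewrite !ltNge (ltW s0) (le_trans (ltW s0) st)/=.
  by rewrite lef_pV2// posrE//; exact: lt_le_trans st.
Qed.

Lemma decreasing_tail_weight : decreasing_weight tail_weight.
Proof.
split=> [s| |s t s0 st]; rewrite /tail_weight.
- by case: ltP => // s0; rewrite invr_ge0 mulr_ge0// qrt_ge0.
- by rewrite ltxx mul0r invr0.
- have t0 := lt_le_trans s0 st.
  rewrite !ltNge (ltW s0) (ltW t0)/= lef_pV2 ?posrE ?mulr_gt0 ?qrt_gt0//.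
  by rewrite ler_pM ?qrt_ge0 ?le_qrt// ltW.
Qed.

Lemma inv_weightE s : 0 <= s -> inv_weight s = tail_weight s * qrt s.
Proof.
rewrite /inv_weight /tail_weight le_eqVlt => /predU1P[<-|s0].
  by rewrite ltxx invr0 mul0r invr0 mul0r.
by rewrite ltNge (ltW s0)/= invfM mulfVK// gt_eqF// qrt_gt0.
Qed.

Definition cutint e x t := Rint (fun s => x s * cutoff inv_weight e s) 0 t.

(** A truncated weighted L1 norm. A bound on it as [e] tends to 0 gives both integrability of
    [x s / s] and a rate for the convergence of [cutint e x]. *)
Definition rho e x := Rint (fun s => `|x s| * cutoff tail_weight e s) 0 1.

Lemma bmf01_cutint e x : 0 < e -> cadlag01 x -> bmf01 (fun s => x s * cutoff inv_weight e s).
Proof.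
move=> e0 xc; apply: bmf01M; first exact: cadlag01_bmf01.
by apply: bmf01_cutoff => //; exact: decreasing_inv_weight.
Qed.

Lemma bmf01_rho e x : 0 < e -> cadlag01 x -> bmf01 (fun s => `|x s| * cutoff tail_weight e s).
Proof.
move=> e0 xc; apply: bmf01M; first exact/bmf01_norm/cadlag01_bmf01.
by apply: bmf01_cutoff => //; exact: decreasing_tail_weight.
Qed.

Lemma Rint_modulus f K s t : int01 f -> (forall r, 0 <= r <= 1 -> `|f r| <= K) ->
  0 <= s <= 1 -> 0 <= t <= 1 -> `|Rint f 0 s - Rint f 0 t| <= K * `|s - t|.
Proof.
move=> fi fK; wlog st : s t / s <= t.
  move=> H s01 t01; have [/H|/ltW/H] := leP s t; first exact.
  by rewrite distrC [`|s - t|]distrC; exact.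
move=> /andP[s0 s1] /andP[t0 t1].
rewrite (@Rint_cat _ f 0 s t)// opprD addNKr normrN.
rewrite [`|s - t|]distrC [`|t - s|]ger0_norm ?subr_ge0//.
by apply: Rint_norm_le_cst => // r /andP[sr rt]; apply: fK; lra.
Qed.

Lemma cutint_unif_continuous e x : 0 < e -> cadlag01 x ->
  forall h, 0 < h -> exists2 l, 0 < l & forall s t,
    0 <= s <= 1 -> 0 <= t <= 1 -> `|s - t| < l -> `|cutint e x s - cutint e x t| <= h.
Proof.
move=> e0 xc h h0; have bf := bmf01_cutint e0 xc; have [_ [K fK]] := bf.
have K0 : 0 <= K by apply: le_trans (fK 0 _); rewrite ?lexx ?ler01.
exists (h / (K + 1)); first by rewrite divr_gt0//; lra.
move=> s t s01 t01 st.
apply: le_trans (Rint_modulus (bmf01_int01 bf) fK s01 t01) _.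
apply: le_trans (_ : K * (h / (K + 1)) <= _); first by rewrite ler_wpM2l// ltW.
rewrite mulrCA -[leRHS]mulr1 ler_wpM2l ?(ltW h0)// ler_pdivrMr; lra.
Qed.

Lemma cadlag01_cutint e x : 0 < e -> cadlag01 x -> cadlag01 (cutint e x).
Proof. by move=> e0 xc; apply/unif_continuous_cadlag01/cutint_unif_continuous. Qed.

(** The cut-off weight is at most [1 / e], so L1-closeness of paths becomes uniform closeness of
    integrals; Skorokhod-closeness gives the former by [skorokhod_L1_continuous]. *)
Lemma cutint_unif_le e x y : 0 < e -> cadlag01 x -> cadlag01 y ->
  unif_le (cutint e x) (cutint e y) (inv_weight e * Rint (fun s => `|x s - y s|) 0 1).
Proof.
move=> e0 xc yc t /andP[t0 t1].
have xi := bmf01_int01 (bmf01_cutint e0 xc).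
have yi := bmf01_int01 (bmf01_cutint e0 yc).
have di : int01 (fun s => `|x s - y s|).
  by apply/bmf01_int01/bmf01_norm/bmf01B; exact: cadlag01_bmf01.
rewrite /cutint -Rint_sub//.
have si : int01 (fun s => x s * cutoff inv_weight e s - y s * cutoff inv_weight e s).
  by apply/bmf01_int01/bmf01B; exact: bmf01_cutint.
apply: le_trans (Rint_norm _ t1 si) _ => //.
apply: (@le_trans _ _ (Rint (fun s => inv_weight e * `|x s - y s|) 0 t)).
  apply: le_Rint => //; first exact: int01_norm.
    apply/bmf01_int01/bmf01M; first exact: bmf01_cst.
    by apply/bmf01_norm/bmf01B; exact: cadlag01_bmf01.
  move=> s _; rewrite -mulrBl normrM mulrC ler_wpM2r//.
  by rewrite ger0_norm ?cutoff_ge0 ?cutoff_le//; exact: decreasing_inv_weight.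
rewrite Rint_Zl// ler_wpM2l//; first by case: decreasing_inv_weight.
exact: Rint_subset.
Qed.

Lemma rho_dist e x y : 0 < e -> cadlag01 x -> cadlag01 y ->
  `|rho e x - rho e y| <= tail_weight e * Rint (fun s => `|x s - y s|) 0 1.
Proof.
move=> e0 xc yc.
have xi := bmf01_int01 (bmf01_rho e0 xc).
have yi := bmf01_int01 (bmf01_rho e0 yc).
have db : bmf01 (fun s => `|x s - y s|).
  by apply/bmf01_norm/bmf01B; exact: cadlag01_bmf01.
rewrite /rho -Rint_sub// -Rint_Zl//; last exact: bmf01_int01.
have sb : bmf01 (fun s => `|x s| * cutoff tail_weight e s - `|y s| * cutoff tail_weight e s).
  by apply/bmf01B; exact: bmf01_rho.
apply: le_trans (Rint_norm _ _ (bmf01_int01 sb)) _ => //.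
apply: le_Rint => //; first exact/int01_norm/bmf01_int01.
  by apply/bmf01_int01/bmf01M => //; exact: bmf01_cst.
move=> s _; rewrite -mulrBl normrM mulrC.
rewrite ler_pM// ?ler_dist_dist//.
by rewrite ger0_norm ?cutoff_ge0 ?cutoff_le//; exact: decreasing_tail_weight.
Qed.

Lemma rho_ge0 e x : 0 <= rho e x.
Proof.
apply: Rint_ge0 => s _; rewrite mulr_ge0// cutoff_ge0//; exact: decreasing_tail_weight.
Qed.

(** The truncation at [M] produces a bounded functional, to which convergence in distribution can be
    applied; the minimum is 1-Lipschitz and does not harm continuity. *)
Lemma skorokhod_continuous_rho e (M : R) : 0 < e ->
  skorokhod_continuous (fun x => Num.min M (rho e x)).
Proof.
move=> e0 x xc eps eps0.
have pe : 0 < tail_weight e + 1 by have [p0 _ _] := decreasing_tail_weight; have := p0 e; lra.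
have [h h0 xh] := skorokhod_L1_continuous xc (divr_gt0 eps0 (mulr_gt0 (ltr0n R 2) pe)).
exists h => // y yc xy; have {}xh := xh y yc xy.
have minL r r' : `|Num.min M r - Num.min M r'| <= `|r - r'|.
  wlog rr' : r r' / r <= r'.
    move=> H; have [/H//|/ltW/H] := leP r r'.
    by rewrite distrC [leRHS]distrC.
  rewrite distrC [leRHS]distrC [leRHS]ger0_norm ?subr_ge0//.
  rewrite ger0_norm ?subr_ge0 ?le_min2//.
  by rewrite /Num.min; case: ifP; case: ifP; lra.
apply: le_lt_trans (minL _ _) _; apply: le_lt_trans (rho_dist e0 xc yc) _.
apply: (@le_lt_trans _ _ ((tail_weight e + 1) * (eps / (2 * (tail_weight e + 1))))).
  apply: ler_pM => //; first by case: decreasing_tail_weight.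
    by apply: Rint_ge0.
  lra.
have -> : (tail_weight e + 1) * (eps / (2 * (tail_weight e + 1))) = eps / 2.
  by field; rewrite gt_eqF.
lra.
Qed.

Section smoothed_functional.
Variables (Phi : (R -> R) -> R) (M : R).
Hypothesis PhiM : forall x, `|Phi x| <= M.

(** The value 0 off cadlag paths keeps the functional bounded on all functions, as
    [bounded_functional] demands; continuity concerns cadlag paths only. *)
Definition smoothed (L e : R) x : R :=
  if `[< cadlag01 x >] then infconv Phi L (cutint e x) else 0.

Lemma smoothedE L e x : cadlag01 x -> smoothed L e x = infconv Phi L (cutint e x).
Proof. by move=> xc; rewrite /smoothed asboolT. Qed.

Lemma smoothed_bound L e x : 0 <= L -> 0 < e -> `|smoothed L e x| <= M.
Proof.
move=> L0 e0; rewrite /smoothed; case: asboolP => xc.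
  by apply: infconv_bound => //; exact: cadlag01_cutint.
by rewrite normr0; apply: le_trans (PhiM x).
Qed.

(** The minorant is [L]-Lipschitz for the uniform distance and [cutint e] is [1 / e]-Lipschitz from
    L1 to it, so the composite inherits continuity from [skorokhod_L1_continuous]. *)
Lemma skorokhod_continuous_smoothed L e : 0 <= L -> 0 < e ->
  skorokhod_continuous (smoothed L e).
Proof.
move=> L0 e0 x xc eps eps0.
have i0 : 0 <= inv_weight e by case: decreasing_inv_weight.
have Le : 0 < L * inv_weight e + 1 by have := mulr_ge0 L0 i0; lra.
have [h h0 xh] := skorokhod_L1_continuous xc (divr_gt0 eps0 (mulr_gt0 (ltr0n R 2) Le)).
exists h => // y yc xy; have {}xh := xh y yc xy.
rewrite !smoothedE//; set r := Rint (fun s => `|x s - y s|) 0 1 in xh *.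
have r0 : 0 <= r by apply: Rint_ge0.
have hxy := cutint_unif_le e0 xc yc; rewrite -/r in hxy.
have hx := cadlag01_cutint e0 xc; have hy := cadlag01_cutint e0 yc.
have ir0 : 0 <= inv_weight e * r by rewrite mulr_ge0.
have l1 := infconv_lipschitz PhiM L0 hx hy ir0 hxy.
have l2 := infconv_lipschitz PhiM L0 hy hx ir0 (unif_leC hxy).
have bnd : L * (inv_weight e * r) <= eps / 2.
  rewrite mulrA; apply: (@le_trans _ _ ((L * inv_weight e + 1) * (eps / (2 * (L * inv_weight e + 1))))).
    apply: ler_pM => //; first by rewrite mulr_ge0.
    lra.
  have -> : (L * inv_weight e + 1) * (eps / (2 * (L * inv_weight e + 1))) = eps / 2.
    by field; rewrite gt_eqF.
  by [].
rewrite ltr_norml; apply/andP; split; lra.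
Qed.

End smoothed_functional.

End weights.

(** * The singular integral of a path near zero *)

Section tail.
Context {R : realType}.
Implicit Types (f g w x y z : R -> R) (a b c e h l s t u v K : R).

(** Monotone convergence as the cut-off [1 / m.+1] decreases to 0. *)
Lemma weighted_integral_le x K : cadlag01 x ->
  (forall m : nat, rho m.+1%:R^-1 x <= K) ->
  int01 (fun s => `|x s| * tail_weight s) /\ Rint (fun s => `|x s| * tail_weight s) 0 1 <= K.
Proof.
move=> xc rK; pose g (m : nat) s : \bar R := (`|x s| * cutoff tail_weight m.+1%:R^-1 s)%:E.
have gb (m : nat) : bmf01 (fun s => `|x s| * cutoff tail_weight m.+1%:R^-1 s).
  by apply: bmf01_rho => //; rewrite invr_gt0.
have p0 s : 0 <= tail_weight s by case: (@decreasing_tail_weight R).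
have x0 s : 0 <= `|x s| * tail_weight s by rewrite mulr_ge0.
have mx : measurable_fun `[0 : R, 1]%classic (fun s => `|x s| * tail_weight s).
  apply: measurable_funM.
    by apply: measurableT_comp => //; exact: cadlag01_measurable.
  by apply: measurable_weight; exact: decreasing_tail_weight.
have IK : (\int[@lebesgue_measure R]_(s in `[0%R, 1%R]%classic) (`|x s| * tail_weight s)%:E <= K%:E)%E.
  have -> : (\int[@lebesgue_measure R]_(s in `[0%R, 1%R]%classic) (`|x s| * tail_weight s)%:E =
      \int[@lebesgue_measure R]_(s in `[0%R, 1%R]%classic) limn (g^~ s))%E.
    apply: eq_integral => s; rewrite inE/= in_itv/= => /andP[s0 s1].
    apply/esym/cvg_lim => //; apply: cvg_EFin.
      by apply: nearW.
    apply: cvgM; first exact: cvg_cst.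
    exact: cutoff_cvg (@decreasing_tail_weight R) s0.
  rewrite monotone_convergence//.
  - apply: lime_le.
      apply: ereal_nondecreasing_is_cvgn => m n mn; apply: ge0_le_integral => //.
      + by move=> s _; rewrite lee_fin mulr_ge0// cutoff_ge0//; exact: decreasing_tail_weight.
      + by apply/measurable_EFinP; case: (gb m).
      + by apply/measurable_EFinP; case: (gb n).
      + move=> s _; rewrite lee_fin ler_wpM2l//; apply: (cutoff_nd s (@decreasing_tail_weight R)) mn.
    apply: nearW => m; rewrite -[leLHS]fineK ?lee_fin; first exact: rK.
    exact: integrable_fin_num (bmf01_int01 (gb m)).
  - by move=> m; apply/measurable_EFinP; case: (gb m).
  - by move=> m s _; rewrite lee_fin mulr_ge0// cutoff_ge0//; exact: decreasing_tail_weight.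
  - by move=> s _ m n mn; rewrite lee_fin ler_wpM2l//; apply: (cutoff_nd s (@decreasing_tail_weight R)) mn.
have xi : int01 (fun s => `|x s| * tail_weight s).
  apply/integrableP; split; first exact/measurable_EFinP.
  apply: le_lt_trans (ltry K); apply: le_trans IK.
  apply: ge0_le_integral => //.
  - by do 2 apply: measurableT_comp => //.
  - exact/measurable_EFinP.
  - by move=> s _ /=; rewrite lee_fin ger0_norm.
split => //; rewrite -lee_fin fineK//.
exact: integrable_fin_num xi.
Qed.

Lemma int01_div x K : cadlag01 x -> (forall m : nat, rho m.+1%:R^-1 x <= K) ->
  int01 (fun s => x s / s).
Proof.
move=> xc /(weighted_integral_le xc)[xi _].
apply: (le_integrable _ _ _ xi) => //.
  apply/measurable_EFinP; apply: (@eq_measurable_fun _ _ _ _ _ (fun s => x s * inv_weight s)).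
    by move=> s; rewrite inE/= in_itv/= => /andP[s0 _]; rewrite /inv_weight ltNge s0.
  apply: measurable_funM; first exact: cadlag01_measurable.
  by apply: measurable_weight; exact: decreasing_inv_weight.
move=> s /=; rewrite in_itv/= => /andP[s0 s1].
have p0 : 0 <= tail_weight s by case: (@decreasing_tail_weight R).
have -> : s^-1 = inv_weight s by rewrite /inv_weight ltNge s0.
rewrite lee_fin !normrM normr_id ler_wpM2l// inv_weightE// normrM ler_piMr//.
by rewrite ger0_norm ?qrt_ge0// -qrt1 le_qrt.
Qed.

(** The two integrands differ only below [e], where [1 / s] is [tail_weight s * qrt s], at most
    [qrt e] times the heavier weight. *)
Lemma cutint_tail x K e : cadlag01 x -> (forall m : nat, rho m.+1%:R^-1 x <= K) ->
  0 < e -> unif_le (fun t => Rint (fun s => x s / s) 0 t) (cutint e x) (qrt e * K).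
Proof.
move=> xc rK e0 t /andP[t0 t1].
have xi := int01_div xc rK.
have [wi wK] := weighted_integral_le xc rK.
have hi := bmf01_int01 (bmf01_cutint e0 xc).
have p0 s : 0 <= tail_weight s by case: (@decreasing_tail_weight R).
rewrite /cutint -Rint_sub//.
have di : int01 (fun s => x s / s - x s * cutoff inv_weight e s).
  by apply: (integrableB _ xi hi).
apply: le_trans (Rint_norm _ t1 di) _ => //.
apply: (@le_trans _ _ (Rint (fun s => qrt e * (`|x s| * tail_weight s)) 0 t)).
  apply: le_Rint => //; first exact: int01_norm.
    exact: (integrableZl _ (qrt e) wi).
  move=> s /andP[s0 st].
  have -> : s^-1 = inv_weight s by rewrite /inv_weight ltNge s0.
  rewrite /cutoff; case: ltP => [se|es].
    rewrite mulr0 subr0 normrM inv_weightE// normrM (ger0_norm (p0 s)).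
    rewrite mulrA mulrC ler_wpM2r ?mulr_ge0//.
    by rewrite ger0_norm ?qrt_ge0// le_qrt// ltW.
  by rewrite subrr normr0 !mulr_ge0// qrt_ge0.
rewrite Rint_Zl// ler_wpM2l ?qrt_ge0//; apply: le_trans wK.
by apply: Rint_subset => // s _; rewrite mulr_ge0.
Qed.

Lemma cadlag01_Rint_div x K : cadlag01 x -> (forall m : nat, rho m.+1%:R^-1 x <= K) ->
  cadlag01 (fun t => Rint (fun s => x s / s) 0 t).
Proof.
move=> xc rK; apply: unif_continuous_cadlag01 => h h0.
have K0 : 0 <= K := le_trans (rho_ge0 _ _) (rK 0%N).
(* With cut-off [l ^+ 4] the uniform error [qrt (l ^+ 4) * K] is [l * K], at most [h / 3]; the path
   is thus a uniform limit of uniformly continuous ones. *)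
pose l := h / (3 * (K + 1)).
have l0 : 0 < l by rewrite divr_gt0//; lra.
have e0 : 0 < l ^+ 4 by rewrite exprn_gt0.
have h3 : 0 < h / 3 by rewrite divr_gt0.
have [d d0 Hd] := cutint_unif_continuous e0 xc h3.
have qK : qrt (l ^+ 4) * K <= h / 3.
  rewrite qrtK ?(ltW l0)// /l.
  have -> : h / (3 * (K + 1)) * K = h / 3 * (K / (K + 1)).
    by field; rewrite gt_eqF//; lra.
  by rewrite -[leRHS]mulr1 ler_wpM2l ?(ltW h3)// ler_pdivrMr; lra.
exists d => // s t s01 t01 st.
have := cutint_tail xc rK e0 s01; have := cutint_tail xc rK e0 t01; have := Hd s t s01 t01 st.
move: (Rint _ 0 s) (Rint _ 0 t) (cutint _ _ s) (cutint _ _ t) => p q p' q' H1 H2 H3.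
have -> : p - q = (p - p') - (q - q') + (p' - q') by ring.
have := ler_normD ((p - p') - (q - q')) (p' - q').
by have := ler_normB (p - p') (q - q'); lra.
Qed.

(** The right endpoint is left out because a step path already takes its next value there. *)
Lemma Rint_norm_le_cst_co f (k : R) a b : 0 <= a -> a <= b -> b <= 1 -> int01 f ->
  (forall s, a <= s < b -> `|f s| <= k) -> `|Rint f a b| <= k * (b - a).
Proof.
move=> a0 ab b1 fi fk.
have co g : int01 g -> (@lebesgue_measure R).-integrable `[a, b[%classic (EFin \o g).
  move=> gi; apply: integrableS (int01_sub a0 b1 gi) => //.
  exact: subset_itv_co_cc.
rewrite /Rint -Rintegral_itv_bndo_bndc; last exact: co.
apply: le_trans (le_normr_Rintegral _ _) _ => //; first exact: co.
have -> : k * (b - a) = \int[@lebesgue_measure R]_(s in `[a, b[) k.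
  rewrite Rintegral_cst//= lebesgue_measure_itv/= lte_fin.
  case: ltP => [_|ba]; first by rewrite -EFinB.
  by have -> : b = a; [apply/eqP; rewrite eq_le ab ba|rewrite subrr].
apply: le_Rintegral => //; first exact/co/int01_norm.
exact/co/bmf01_int01/bmf01_cst.
Qed.

Lemma truncn_cell (n k : nat) s : (0 < n)%N -> k%:R / n%:R <= s < k.+1%:R / n%:R ->
  Num.truncn (n%:R * s) = k.
Proof.
move=> n0 /andP[ks sk]; have nR : 0 < n%:R :> R by rewrite ltr0n.
by apply: truncn_def; rewrite mulrC -ler_pdivrMr// ks -ltr_pdivlMr.
Qed.

(** * Step paths on the grid [k / n] *)

Section step.
Variables (b : nat -> R) (n : nat).
Hypothesis n0 : (0 < n)%N.
Hypothesis b0 : b 0%N = 0.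

Let X s := b (Num.truncn (n%:R * s)).
Let nR : 0 < n%:R :> R. Proof. by rewrite ltr0n. Qed.

Lemma grid_le1 (k : nat) : (k <= n)%N -> k%:R / n%:R <= 1 :> R.
Proof. by move=> kn; rewrite ler_pdivrMr// mul1r ler_nat. Qed.

Lemma grid_le (k : nat) : k%:R / n%:R <= k.+1%:R / n%:R :> R.
Proof. by rewrite ler_pM2r ?invr_gt0// ler_nat. Qed.

Lemma grid_sub (k : nat) : k.+1%:R / n%:R - k%:R / n%:R = n%:R^-1 :> R.
Proof. by rewrite -mulrBl -natr1 addrC addKr mul1r. Qed.

Lemma tail_weight_grid (i : nat) : tail_weight (i%:R / n%:R) / n%:R = qrt n%:R / (i%:R * qrt i%:R) :> R.
Proof.
rewrite /tail_weight ltNge divr_ge0//=; have [->|i0] := posnP i.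
  by rewrite !mul0r invr0 mul0r mulr0.
have iR : 0 < i%:R :> R by rewrite ltr0n.
rewrite qrtM// qrtV//; field.
by rewrite !gt_eqF ?qrt_gt0.
Qed.

(** On each cell the weight is at most its value at the left end. The first cell, where that fails,
    contributes nothing as [b 0 = 0]. The bound is free of [e]. *)
Lemma rho_step e : 0 < e ->
  rho e X <= \sum_(k < n) `|b k| * (qrt n%:R / (k%:R * qrt k%:R)).
Proof.
move=> e0; rewrite /rho; set f := fun s => _.
have fi : int01 f by apply/bmf01_int01/bmf01_rho => //; exact: cadlag01_step.
have p0 s : 0 <= tail_weight s by case: (@decreasing_tail_weight R).
suff H : forall i, (i <= n)%N -> Rint f 0 (i%:R / n%:R) <=
    \sum_(k < i) `|b k| * (qrt n%:R / (k%:R * qrt k%:R)).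
  by have := H n (leqnn n); rewrite mulfV ?gt_eqF.
elim => [_|i IH lin].
  by rewrite mul0r big_ord0 /Rint set_itv1 Rintegral_set1.
rewrite (@Rint_cat _ f 0 (i%:R / n%:R))//; [|exact: grid_le|exact: grid_le1].
rewrite big_ord_recr/= lerD ?IH ?(ltnW lin)//.
apply: le_trans (ler_norm _) _.
apply: le_trans (@Rint_norm_le_cst_co f (`|b i| * tail_weight (i%:R / n%:R)) _ _ _ _ _ _ _) _ => //.
- exact: grid_le.
- exact: grid_le1.
- move=> s /[dup] sc /(truncn_cell n0) ti; rewrite /f /X ti.
  have [->|i0] := posnP i; first by rewrite b0 normr0 !mul0r normr0.
  rewrite normrM normr_id ler_wpM2l// ger0_norm ?cutoff_ge0//; last exact: decreasing_tail_weight.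
  apply: le_trans (cutoff_le_weight _ _ (@decreasing_tail_weight R)) _.
  have [_ _] := @decreasing_tail_weight R; apply; last by case/andP: sc.
  by rewrite divr_gt0// ltr0n.
by rewrite grid_sub -mulrA tail_weight_grid.
Qed.

Lemma rho_step_le : forall m : nat, rho m.+1%:R^-1 X <=
  \sum_(k < n) `|b k| * (qrt n%:R / (k%:R * qrt k%:R)).
Proof. by move=> m; apply: rho_step; rewrite invr_gt0. Qed.

(* The [k]-th cell contributes [b k / k] up to [`|b k| / k ^ 2]; the cell containing
   [t] is only partially covered. *)
Lemma Rint_div_step t (m : nat) : m = Num.truncn (n%:R * t) -> 0 <= t <= 1 ->
  `|Rint (fun s => X s / s) 0 t - \sum_(k < m.+1) b k / k%:R| <=
  \sum_(k < m) `|b k| / k%:R ^+ 2 + 2 * (`|b m| / m%:R).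
Proof.
move=> mE /andP[t0 t1]; set f := fun s => X s / s.
have fi : int01 f := int01_div (cadlag01_step b n) rho_step_le.
(* On the cell [f s] is [b k / s], and [1 / s] lies between [n / k.+1] and [n / k], which differ by
   at most [n / k ^ 2]. *)
have cell (k : nat) s : k%:R / n%:R <= s < k.+1%:R / n%:R ->
    `|f s - b k * (n%:R / k%:R)| <= `|b k| * (n%:R / k%:R ^+ 2).
  move=> /[dup] sc /(truncn_cell n0) tk; rewrite /f /X tk.
  have [->|k0] := posnP k; first by rewrite b0 !mul0r subrr normr0 mul0r.
  have kR : 0 < k%:R :> R by rewrite ltr0n.
  rewrite -mulrBr normrM ler_wpM2l//.
  have /andP[ks sk] := sc.
  have s0 : 0 < s by apply: lt_le_trans ks; rewrite divr_gt0.
  have sV : s^-1 <= n%:R / k%:R.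
    by rewrite -[n%:R / k%:R]invrK lef_pV2 ?posrE ?invr_gt0 ?divr_gt0// invf_div.
  have sV' : n%:R / k.+1%:R <= s^-1.
    by rewrite -[n%:R / k.+1%:R]invrK lef_pV2 ?posrE ?invr_gt0 ?divr_gt0// invf_div ltW.
  rewrite distrC ger0_norm ?subr_ge0//.
  apply: le_trans (_ : n%:R / k%:R - n%:R / k.+1%:R <= _); first by rewrite lerB.
  rewrite -mulrBr ler_pM2l//.
  have -> : k%:R^-1 - k.+1%:R^-1 = (k%:R * k.+1%:R)^-1 :> R.
    by rewrite -natr1; field; rewrite !gt_eqF ?addr_gt0.
  by rewrite lef_pV2 ?posrE ?mulr_gt0 ?exprn_gt0// expr2 ler_pM2l// ler_nat.
have full (i : nat) : (i <= n)%N ->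
    `|Rint f 0 (i%:R / n%:R) - \sum_(k < i) b k / k%:R| <= \sum_(k < i) `|b k| / k%:R ^+ 2.
  elim: i => [_|i IH lin].
    by rewrite mul0r !big_ord0 /Rint set_itv1 Rintegral_set1 subrr normr0.
  rewrite (@Rint_cat _ f 0 (i%:R / n%:R))//; [|exact: grid_le|exact: grid_le1].
  rewrite !big_ord_recr/= opprD addrACA.
  apply: le_trans (ler_normD _ _) _; rewrite lerD ?IH ?(ltnW lin)//.
  have i1 := grid_le1 lin.
  have ci : int01 (fun=> b i * (n%:R / i%:R)) by exact/bmf01_int01/bmf01_cst.
  have -> : b i / i%:R = Rint (fun=> b i * (n%:R / i%:R)) (i%:R / n%:R) (i.+1%:R / n%:R).
    rewrite Rint_cst ?grid_le// grid_sub -mulrA; congr (_ * _).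
    by rewrite mulrAC mulfV ?gt_eqF// mul1r.
  rewrite -Rint_sub//.
  apply: le_trans (@Rint_norm_le_cst_co _ (`|b i| * (n%:R / i%:R ^+ 2)) _ _ _ _ _ _ _) _ => //.
  - exact: grid_le.
  - exact: (integrableB _ fi ci).
  - by move=> s sc; exact: cell.
  - by rewrite grid_sub -mulrA mulrAC mulfV ?gt_eqF// mul1r.
have /andP[mt tm] := truncn_div_itv n0 t0; rewrite -mE in mt tm.
have mn : (m <= n)%N by rewrite mE; exact: truncn_le_mul.
rewrite (@Rint_cat _ f 0 (m%:R / n%:R))// big_ord_recr/=.
have -> : forall p q r r' : R, p + q - (r + r') = (p - r) + (q - r') by move=> *; ring.
apply: le_trans (ler_normD _ _) _; apply: lerD; first exact: full.
(* The integral over the partial cell and the full term [b m / m] are each at most [|b m| / m],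
   whence the factor 2. *)
have -> : 2 * (`|b m| / m%:R) = `|b m| / m%:R + `|b m| / m%:R by ring.
apply: le_trans (ler_normB _ _) _; rewrite lerD//; last first.
  by rewrite normrM ler_wpM2l// ger0_norm// invr_ge0.
apply: le_trans (@Rint_norm_le_cst_co _ (`|b m| * (n%:R / m%:R)) _ _ _ _ _ _ _) _ => //.
- move=> s /andP[ms st].
  have sc : m%:R / n%:R <= s < m.+1%:R / n%:R.
    rewrite ms (lt_trans st)// (lt_le_trans tm)// -[X in _ + X]mul1r -mulrDl.
    by rewrite natr1.
  rewrite /f /X (truncn_cell n0 sc).
  have [->|m0] := posnP m; first by rewrite b0 mul0r normr0 mul0r.
  have s0 : 0 < s by apply: lt_le_trans ms; rewrite divr_gt0// ltr0n.
  rewrite normrM ler_wpM2l// ger0_norm ?invr_ge0 ?(ltW s0)//.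
  by rewrite -[n%:R / m%:R]invrK lef_pV2 ?posrE ?invr_gt0 ?divr_gt0 ?ltr0n// invf_div.
- have : t - m%:R / n%:R <= n%:R^-1 by lra.
  move=> /(ler_wpM2l _)-/(_ (`|b m| * (n%:R / m%:R))); rewrite mulr_ge0 ?divr_ge0//.
  move=> /(_ isT)/le_trans; apply.
  by rewrite -mulrA mulrAC mulfV ?gt_eqF// mul1r.
Qed.

End step.
End tail.

(** * Comparison of the log-product with the singular integral *)

Section deterministic.
Context {R : realType}.
Implicit Types (c e h l t u v K L : R).

(** The logarithm lies between [u / (1 + u)] and [u]; the gap [u ^ 2 / (1 + u)] is at most
    [2 * u ^ 2] because [1 + u] is at least 1/2. *)
Lemma ln1D_sub_le u h : h <= 2^-1 -> `|u| <= h -> `|ln (1 + u) - u| <= 2 * h * `|u|.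
Proof.
move=> h2 uh; have := uh; rewrite ler_norml => /andP[u1 u2].
have up : ln (1 + u) <= u by apply: le_ln1Dx; lra.
have u0 : 0 < 1 + u by lra.
have low : u / (1 + u) <= ln (1 + u).
  have -> : ln (1 + u) = - ln ((1 + u)^-1) by rewrite lnV ?posrE// opprK.
  rewrite lerNr; have /le_ln1Dx : -1 < - (u / (1 + u)).
    by rewrite ltrN2 ltr_pdivrMr//; lra.
  by have -> : 1 + - (u / (1 + u)) = (1 + u)^-1 by field; rewrite gt_eqF.
rewrite distrC ger0_norm ?subr_ge0//.
apply: le_trans (_ : u - u / (1 + u) <= _); first by rewrite lerB.
have -> : u - u / (1 + u) = u ^+ 2 / (1 + u) by field; rewrite gt_eqF.
rewrite ler_pdivrMr// -real_normK ?num_real// expr2.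
have a0 := normr_ge0 u.
have aa : `|u| * `|u| <= h * `|u| by rewrite ler_wpM2r.
have : 0 <= h * `|u| * (2 * (1 + u) - 1).
  by rewrite mulr_ge0//; [rewrite mulr_ge0//; lra|lra].
lra.
Qed.

Lemma sum_cut_le (N k0 : nat) (c : nat -> R) : (forall k, 0 <= c k) ->
  \sum_(k < N) (if (k < k0)%N then c k else 0) <= \sum_(k < k0) c k.
Proof.
move=> c0; rewrite -big_mkcond/=.
rewrite (big_ord_widen_cond (N + k0) (fun k => (k < k0)%N) c) ?leq_addr//.
rewrite (big_ord_widen (N + k0) c) ?leq_addl//.
rewrite big_mkcond [leRHS]big_mkcond/= ler_sum// => k _.
by case: (k < k0)%N => //=; case: ifP.
Qed.

Lemma sum_widen_le (m N : nat) (c : nat -> R) : (forall k, 0 <= c k) -> (m <= N)%N ->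
  \sum_(k < m) c k <= \sum_(k < N) c k.
Proof.
move=> c0 mN; rewrite (big_ord_widen N c mN) big_mkcond ler_sum// => k _.
by case: ifP.
Qed.

Lemma ler_bigterm (N k : nat) (c : nat -> R) : (forall k, 0 <= c k) -> (k < N)%N ->
  c k <= \sum_(i < N) c i.
Proof.
by move=> c0 kN; rewrite (bigD1 (Ordinal kN))//= lerDl sumr_ge0.
Qed.

(** The left side collects the errors of linearizing [ln], of replacing cell integrals by terms, and
    of the partial cell. Terms below [k0] are kept as a sum independent of [n]. Beyond [k0],
    linearization costs [2 * h * |x k|] and discretization [|x k| / k <= h * |x k|], together the
    factor 3; the partial cell adds [2 * h]. *)
Lemma linearization_error (x : nat -> R) (n k0 m : nat) h :
  h <= 2^-1 -> (0 < k0)%N -> k0%:R^-1 <= h ->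
  (forall k, (k0 <= k <= n)%N -> `|x k| <= h) -> (m <= n)%N ->
  \sum_(k < m.+1) `|ln (1 + x k) - x k| + \sum_(k < m) `|x k| / k%:R + 2 * `|x m| <=
  \sum_(k < k0) (`|ln (1 + x k) - x k| + 3 * `|x k|) + 2 * h
   + 3 * h * \sum_(k < n.+1) `|x k|.
Proof.
move=> h2 k00 k0h xh mn.
have h0 : 0 <= h by apply: le_trans k0h; rewrite invr_ge0.
pose e k := `|ln (1 + x k) - x k|.
pose c k := e k + `|x k|.
have e0 k : 0 <= e k by exact: normr_ge0.
have c0 k : 0 <= c k by rewrite /c addr_ge0.
have B1 : \sum_(k < m.+1) e k + \sum_(k < m) `|x k| / k%:R <=
    \sum_(k < n.+1) (e k + `|x k| / k%:R).
  rewrite big_split/= lerD//.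
    exact: (@sum_widen_le _ _ e).
  apply: (@sum_widen_le _ _ (fun k => `|x k| / k%:R)); last exact: leqW.
  by move=> k; rewrite divr_ge0.
have B2 : \sum_(k < n.+1) (e k + `|x k| / k%:R) <=
    \sum_(k < k0) c k + 3 * h * \sum_(k < n.+1) `|x k|.
  apply: le_trans (lerD (@sum_cut_le n.+1 k0 c c0) (lexx _)).
  rewrite mulr_sumr -big_split/=; apply: ler_sum => k _.
  case: ltnP => [kk0|k0k].
    have k1 : `|x k| / k%:R <= `|x k|.
      have [->|kp] := posnP k; first by rewrite invr0 mulr0.
      by rewrite ler_piMr// invf_le1 ?ltr0n// ler1n.
    have := mulr_ge0 h0 (normr_ge0 (x k)); rewrite /c; lra.
  have xk : `|x k| <= h by apply: xh; rewrite k0k -ltnS ltn_ord.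
  have := ln1D_sub_le h2 xk; rewrite -/(e k).
  have kR : 0 < k%:R :> R by rewrite ltr0n (leq_trans k00).
  have : `|x k| / k%:R <= `|x k| * h.
    rewrite ler_wpM2l// (le_trans _ k0h)//.
    by rewrite lef_pV2 ?posrE// ?ler_nat// ltr0n.
  lra.
have B3 : 2 * `|x m| <= \sum_(k < k0) 2 * `|x k| + 2 * h.
  have [mk0|k0m] := ltnP m k0.
    have := @ler_bigterm k0 m (fun k => 2 * `|x k|) _ mk0.
    move=> /(_ _)/le_trans; apply; last lra.
    by move=> k; rewrite mulr_ge0.
  have := xh m; rewrite k0m mn => /(_ isT).
  have : 0 <= \sum_(k < k0) 2 * `|x k| by apply: sumr_ge0 => k _; rewrite mulr_ge0.
  lra.
have -> : \sum_(k < k0) (`|ln (1 + x k) - x k| + 3 * `|x k|) =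
    \sum_(k < k0) c k + \sum_(k < k0) 2 * `|x k|.
  rewrite -big_split/=; apply: eq_bigr => k _; rewrite /c /e; lra.
rewrite -/(e m) in B1 *; lra.
Qed.

Lemma nat_between_fourth_powers (j0 k : nat) : (j0 ^ 4 <= k)%N ->
  exists2 j, (j0 <= j)%N & (j ^ 4 <= k < j.+1 ^ 4)%N.
Proof.
move=> /subnK <-; elim: (k - j0 ^ 4)%N => [|i [j j0j /andP[ji ij]]].
  by exists j0; rewrite ?leqnn ?add0n ?ltn_exp2r ?leqnn.
have [lt|ge] := ltnP (i.+1 + j0 ^ 4) (j.+1 ^ 4).
  by exists j => //; rewrite lt andbT (leq_trans ji)// addSn.
exists j.+1; first exact: leqW.
rewrite ge/= (@leq_ltn_trans (j.+1 ^ 4))//; last by rewrite ltn_exp2r.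
Qed.

(* Monotonicity propagates the relative error from the subsequence [j ^ 4], whose
   consecutive ratios tend to 1, to all indices. *)
Lemma fourth_power_interpolation (s : nat -> R) (mu eta : R) (j0 n : nat) :
  0 < mu -> (0 < j0)%N -> j0%:R^-1 <= eta -> 62 * eta <= 1 ->
  (forall k, (0 < k)%N -> s k <= s k.+1) ->
  (forall j, (j0 <= j <= n.+1)%N ->
    `|s (j ^ 4)%N - (j ^ 4)%:R * mu| <= eta * ((j ^ 4)%:R * mu)) ->
  forall k, (j0 ^ 4 <= k <= n)%N -> `|s k - k%:R * mu| <= 31 * eta * (k%:R * mu).
Proof.
move=> mu0 j00 j0e eta62 s_nd sj k /andP[j0k kn].
have eta0 : 0 <= eta by apply: le_trans j0e; rewrite invr_ge0.
have [j j0j /andP[jk kj]] := nat_between_fourth_powers j0k.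
have jp : (0 < j)%N by exact: leq_trans j0j.
have jn : (j <= n)%N.
  by apply: leq_trans kn; apply: leq_trans jk; rewrite -{1}(expn1 j) leq_pexp2l.
have mono (a b : nat) : (0 < a)%N -> (a <= b)%N -> s a <= s b.
  move=> a0 /subnK <-; elim: (b - a)%N => [//|i IH].
  by rewrite addSn (le_trans IH)// s_nd// addn_gt0 a0 orbT.
have s1 : s (j ^ 4)%N <= s k by apply: mono => //; rewrite expn_gt0 jp.
have s2 : s k <= s (j.+1 ^ 4)%N by apply: mono => //; [apply: leq_trans jk; rewrite expn_gt0 jp|exact: ltnW].
have := sj j; rewrite j0j (leqW jn) => /(_ isT); rewrite ler_distl => /andP[l1 _].
have := sj j.+1; rewrite (leqW j0j) ltnS jn => /(_ isT); rewrite ler_distl => /andP[_ l2].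
pose a : R := j%:R.
have a0 : 0 < a by rewrite ltr0n.
have ae : 1 <= eta * a.
  rewrite -ler_pdivrMr// mul1r (le_trans _ j0e)//.
  by rewrite lef_pV2 ?posrE ?ltr0n// ler_nat.
have jk' : a ^+ 4 <= k%:R by rewrite -natrX ler_nat.
have kj' : k%:R <= (a + 1) ^+ 4 by rewrite natr1 -natrX ler_nat ltnW.
(* [15 = 4 + 6 + 4 + 1]: each lower power of [a] is at most [a ^ 3], hence at most [eta * a ^ 4]. *)
have r1 : (a + 1) ^+ 4 <= (1 + 15 * eta) * a ^+ 4.
  have a1 : 1 <= a by rewrite ler1n.
  have -> : (a + 1) ^+ 4 = a ^+ 4 + 4 * a ^+ 3 + 6 * a ^+ 2 + 4 * a + 1 by ring.
  have p3 : a ^+ 3 <= eta * a ^+ 4.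
    have -> : eta * a ^+ 4 = (eta * a) * a ^+ 3 by ring.
    by rewrite ler_peMl// exprn_ge0// ltW.
  have p2 : a ^+ 2 <= a ^+ 3 by apply: ler_weXn2l.
  have p1 : a <= a ^+ 3 by rewrite -[leLHS]expr1; apply: ler_weXn2l.
  have p0 : 1 <= a ^+ 3 by rewrite exprn_ege1.
  lra.
have kmu : 0 <= k%:R * mu by rewrite mulr_ge0// ltW.
rewrite ler_distl; apply/andP; split.
  apply: le_trans s1; rewrite natrX -/a in l1.
  have -> : k%:R * mu - 31 * eta * (k%:R * mu) = (1 - 31 * eta) * k%:R * mu by ring.
  apply: le_trans (_ : (1 - eta) * a ^+ 4 * mu <= _); last lra.
  rewrite ler_pM2r//.
  apply: le_trans (_ : (1 - 31 * eta) * ((1 + 15 * eta) * a ^+ 4) <= _).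
    by rewrite ler_wpM2l//; [lra|exact: le_trans kj' r1].
  rewrite mulrA ler_pM2r ?exprn_gt0//.
  have : 0 <= eta * eta by rewrite mulr_ge0.
  lra.
apply: le_trans s2 _; rewrite natrX -natr1 -/a in l2.
apply: le_trans l2 _.
have -> : (a + 1) ^+ 4 * mu + eta * ((a + 1) ^+ 4 * mu) = (1 + eta) * (a + 1) ^+ 4 * mu by ring.
have -> : k%:R * mu + 31 * eta * (k%:R * mu) = (1 + 31 * eta) * k%:R * mu by ring.
rewrite ler_pM2r//.
(* [(1 + eta) * (1 + 15 * eta) = 1 + 16 * eta + 15 * eta ^ 2], at most [1 + 31 * eta] since
   [eta <= 1]: the origin of 31. *)
apply: le_trans (_ : (1 + eta) * ((1 + 15 * eta) * k%:R) <= _).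
  rewrite ler_wpM2l//; first lra.
  apply: le_trans r1 _; rewrite ler_wpM2l//; lra.
rewrite mulrA ler_wpM2r//.
have : eta * eta <= eta * 1 by rewrite ler_wpM2l//; lra.
lra.
Qed.

(** * The logarithm of the product along one trajectory *)

Section path.
Variables (s : nat -> R) (mu sigma : R).
Hypothesis mu0 : 0 < mu.
Hypothesis sigma0 : 0 < sigma.
Hypothesis s0 : s 0%N = 0.
Hypothesis sp : forall k, (0 < k)%N -> 0 < s k.

Definition relerr (k : nat) := (s k - k%:R * mu) / (k%:R * mu).
Definition increment (n k : nat) := (s k - k%:R * mu) / (sigma * Num.sqrt n%:R).
Definition logprod (n : nat) t :=
  mu / sigma / Num.sqrt n%:R * \sum_(k < (Num.truncn (n%:R * t)).+1) ln (1 + relerr k).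

Lemma relerr0 : relerr 0 = 0.
Proof. by rewrite /relerr s0 !mul0r subrr mul0r. Qed.

Lemma expR_logprod (n : nat) t :
  (\prod_(1 <= k < (Num.truncn (n%:R * t)).+1) (s k / (k%:R * mu)))
    `^ ((mu / sigma) / Num.sqrt n%:R) = expR (logprod n t).
Proof.
rewrite /logprod; set m := Num.truncn _.
have prodP (i : nat) : 0 < \prod_(1 <= k < i.+1) (s k / (k%:R * mu)).
  elim: i => [|i IH]; first by rewrite big_geq.
  by rewrite big_nat_recr//= mulr_gt0// divr_gt0 ?sp// mulr_gt0.
rewrite /powR gt_eqF//; congr (expR (_ * _)).
elim: m => [|m IH].
  by rewrite big_geq// big_ord_recr big_ord0 /= relerr0 addr0 ln1 addr0.
rewrite big_nat_recr//= big_ord_recr/= -IH lnM ?posrE//; last first.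
  by rewrite divr_gt0 ?sp// mulr_gt0.
have r0 : m.+1%:R * mu != 0 by rewrite gt_eqF// mulr_gt0.
by congr (_ + ln _); rewrite /relerr mulrBl mulfV// addrC subrK.
Qed.

Lemma cadlag01_logprod (n : nat) : cadlag01 (logprod n).
Proof.
exact: (cadlag01_step (fun m => mu / sigma / Num.sqrt n%:R * \sum_(k < m.+1) ln (1 + relerr k)) n).
Qed.

(** The choice [gamma = mu / sigma] makes [increment n k / k] equal to [gamma / sqrt n] times
    [relerr k], so the singular integral of the step path and the linearized log-product are the
    same sum up to the errors of [Rint_div_step]. *)
Lemma logprod_close (n k0 : nat) h : (0 < n)%N -> h <= 2^-1 -> (0 < k0)%N ->
  k0%:R^-1 <= h -> (forall k, (k0 <= k <= n)%N -> `|relerr k| <= h) ->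
  unif_le (logprod n)
    (fun t => Rint (fun r => increment n (Num.truncn (n%:R * r)) / r) 0 t)
    (mu / sigma / Num.sqrt n%:R *
      (\sum_(k < k0) (`|ln (1 + relerr k) - relerr k| + 3 * `|relerr k|) + 2 * h
       + 3 * h * \sum_(k < n.+1) `|relerr k|)).
Proof.
move=> n0 h2 k00 k0h xh t t01.
set m := Num.truncn (n%:R * t).
have mn : (m <= n)%N by apply: truncn_le_mul; case/andP: t01.
have rn0 : 0 < Num.sqrt n%:R :> R by rewrite sqrtr_gt0 ltr0n.
pose g := mu / sigma / Num.sqrt n%:R.
have g0 : 0 <= g by rewrite !divr_ge0 ?ltW.
have incE k : increment n k / k%:R = g * relerr k.
  have [->|k0'] := posnP k; first by rewrite relerr0 mulr0 invr0 mulr0.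
  rewrite /increment /g /relerr; field.
  by rewrite !gt_eqF ?ltr0n.
have inc0 : increment n 0 = 0 by rewrite /increment s0 mul0r subrr mul0r.
have step := Rint_div_step n0 inc0 erefl t01; rewrite -/m in step.
rewrite (eq_bigr (fun k : 'I_m.+1 => g * relerr k)) in step; last by move=> k _; exact: incE.
have incN k : `|increment n k| / k%:R = g * `|relerr k|.
  have -> : k%:R^-1 = `|k%:R^-1| :> R by rewrite ger0_norm ?invr_ge0.
  by rewrite -normrM incE normrM ger0_norm.
rewrite (eq_bigr (fun k : 'I_m => g * (`|relerr k| / k%:R))) in step; last first.
  by move=> k _; rewrite expr2 invfM mulrA incN mulrA.
rewrite incN -!mulr_sumr in step.
rewrite /logprod -/m -/g; set I := Rint _ 0 t in step *.
have -> : g * \sum_(k < m.+1) ln (1 + relerr k) - I =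
  g * \sum_(k < m.+1) (ln (1 + relerr k) - relerr k) - (I - g * \sum_(k < m.+1) relerr k).
  by rewrite sumrB; ring.
apply: le_trans (ler_normB _ _) _.
apply: le_trans (lerD (lexx _) step) _.
rewrite normrM (ger0_norm g0).
apply: le_trans (_ : g * (\sum_(k < m.+1) `|ln (1 + relerr k) - relerr k| +
   \sum_(k < m) `|relerr k| / k%:R + 2 * `|relerr m|) <= _); last first.
  by rewrite ler_wpM2l//; exact: linearization_error.
have tri : `|\sum_(k < m.+1) (ln (1 + relerr k) - relerr k)| <=
    \sum_(k < m.+1) `|ln (1 + relerr k) - relerr k| by exact: ler_norm_sum.
have := ler_wpM2l g0 tri; lra.
Qed.

End path.
End deterministic.

(** * Sums of powers by telescoping *)

Section sums.
Context {R : realType}.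

(** Each term [1 / sqrt k] is at most [2 * (sqrt k - sqrt (k - 1))]; the term at 0 vanishes by
    convention. *)
Lemma sum_sqrt_div_le (n : nat) :
  \sum_(k < n.+1) Num.sqrt k%:R / k%:R <= 2 * Num.sqrt n%:R :> R.
Proof.
elim: n => [|n IH].
  by rewrite big_ord_recr big_ord0/= sqrtr0 mul0r addr0 mulr0.
rewrite big_ord_recr/=; apply: le_trans (lerD IH (lexx _)) _.
set v := Num.sqrt n%:R; set u := Num.sqrt n.+1%:R.
have u0 : 0 < u by rewrite sqrtr_gt0 ltr0n.
have v0 : 0 <= v := sqrtr_ge0 _.
have uu : n.+1%:R = u ^+ 2 by rewrite sqr_sqrtr.
have vv : u ^+ 2 = v ^+ 2 + 1 by rewrite -uu sqr_sqrtr// natr1.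
have vu : v <= u by rewrite ler_wsqrtr// ler_nat.
have -> : u / n.+1%:R = u^-1 by rewrite uu; field; rewrite gt_eqF.
rewrite -lerBrDl -mulrBr -[leLHS]mul1r ler_pdivrMr//.
have : 0 <= (u - v) * (u - v) by rewrite mulr_ge0// subr_ge0.
rewrite !expr2 in vv; lra.
Qed.

(** Discrete form of the integral of [s^(1/2 - 5/4)]: each [k^(-3/4)] is at most 4 times the
    increment of the fourth root. *)
Lemma sum_qrt_div_le (n : nat) :
  \sum_(k < n) Num.sqrt k%:R * (qrt n%:R / (k%:R * qrt k%:R)) <= 4 * Num.sqrt n%:R :> R.
Proof.
have H (m : nat) : \sum_(k < m.+1) Num.sqrt k%:R / (k%:R * qrt k%:R) <= 4 * qrt m%:R :> R.
  elim: m => [|m IH].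
    by rewrite big_ord_recr big_ord0/= sqrtr0 mul0r addr0 mulr_ge0// qrt_ge0.
  rewrite big_ord_recr/=; apply: le_trans (lerD IH (lexx _)) _.
  set v := qrt m%:R; set u := qrt m.+1%:R.
  have u0 : 0 < u by rewrite qrt_gt0// ltr0n.
  have v0 : 0 <= v := qrt_ge0 _.
  have um : Num.sqrt m.+1%:R = u ^+ 2 by rewrite sqr_sqrtr// sqrtr_ge0.
  have uu : m.+1%:R = u ^+ 4 by rewrite qrtX4.
  have vv : u ^+ 4 = v ^+ 4 + 1 by rewrite -uu qrtX4// natr1.
  have vu : 0 <= u - v by rewrite subr_ge0 le_qrt// ler_nat.
  have -> : Num.sqrt m.+1%:R / (m.+1%:R * u) = (u ^+ 3)^-1.
    by rewrite um uu; field; rewrite gt_eqF.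
  rewrite -lerBrDl -mulrBr -[leLHS]mul1r ler_pdivrMr ?exprn_gt0//.
  (* The three products add up to [4 * u ^ 3 * (u - v) - (u ^ 4 - v ^ 4) = (u - v) ^ 2 * (3 * u ^ 2
     + 2 * u * v + v ^ 2)]. *)
  have p1 : 0 <= (u - v) * (u - v) * (u ^+ 2) by apply: mulr_ge0; [exact: mulr_ge0|exact: sqr_ge0].
  have p2 : 0 <= (u - v) * (u - v) * (u * (u + v)).
    by apply: mulr_ge0; [exact: mulr_ge0|rewrite mulr_ge0 ?addr_ge0// ltW].
  have p3 : 0 <= (u - v) * (u - v) * (u ^+ 2 + u * v + v ^+ 2).
    apply: mulr_ge0; first exact: mulr_ge0.
    by rewrite addr_ge0 ?sqr_ge0// addr_ge0 ?sqr_ge0// mulr_ge0// ltW.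
  lra.
have -> : \sum_(k < n) Num.sqrt k%:R * (qrt n%:R / (k%:R * qrt k%:R)) =
    qrt n%:R * \sum_(k < n) Num.sqrt k%:R / (k%:R * qrt k%:R) :> R.
  by rewrite mulr_sumr; apply: eq_bigr => k _; rewrite mulrCA mulrA.
have -> : Num.sqrt n%:R = qrt n%:R * qrt n%:R :> R by rewrite -expr2 sqr_sqrtr// sqrtr_ge0.
rewrite mulrCA ler_wpM2l// ?qrt_ge0//; apply: le_trans (H n).
apply: (@sum_widen_le _ n n.+1 (fun k => Num.sqrt k%:R / (k%:R * qrt k%:R))) => // k.
by rewrite divr_ge0 ?sqrtr_ge0// mulr_ge0// qrt_ge0.
Qed.

(** With [j = i0.+1 + i] the terms are [j^(-2)], at most [1 / (j - 1) - 1 / j]. Being small for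
    large [i0], this sum bounds the probability of a large relative error along [j^4]. *)
Lemma sum_inv_sqr_le (i0 N : nat) : (0 < i0)%N ->
  \sum_(i < N) Num.sqrt ((i0.+1 + i) ^ 4)%:R / ((i0.+1 + i) ^ 4)%:R <= i0%:R^-1 :> R.
Proof.
move=> i00.
suff H : \sum_(i < N) Num.sqrt ((i0.+1 + i) ^ 4)%:R / ((i0.+1 + i) ^ 4)%:R
    <= i0%:R^-1 - (i0 + N)%:R^-1 :> R.
  by apply: le_trans H _; rewrite lerBlDr lerDl invr_ge0.
elim: N => [|N IH]; first by rewrite big_ord0 addn0 subrr.
rewrite big_ord_recr/=; apply: le_trans (lerD IH (lexx _)) _.
rewrite addSn addnS; set a : R := (i0 + N)%:R.
have a0 : 0 < a by rewrite ltr0n addn_gt0 i00.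
have -> : ((i0 + N).+1 ^ 4)%:R = ((a + 1) ^+ 2) ^+ 2 :> R.
  by rewrite natr1 -exprM natrX.
rewrite -natr1 -/a sqrtr_sqr ger0_norm ?sqr_ge0//.
have -> : (a + 1) ^+ 2 / (a + 1) ^+ 2 ^+ 2 = ((a + 1) ^+ 2)^-1.
  by field; rewrite gt_eqF//; lra.
have : ((a + 1) ^+ 2)^-1 <= a^-1 - (a + 1)^-1.
  have -> : a^-1 - (a + 1)^-1 = (a * (a + 1))^-1 by field; rewrite !gt_eqF//; lra.
  rewrite lef_pV2 ?posrE ?exprn_gt0 ?mulr_gt0//; [|lra|lra].
  by rewrite expr2 ler_pM2r; lra.
lra.
Qed.
End sums.

(** * Pathwise comparison of the minorant with the log-product *)

Section pointwise.
Context {R : realType}.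
Variables (Phi : (R -> R) -> R) (M : R).
Hypothesis PhiM : forall x, `|Phi x| <= M.
Variables (s : nat -> R) (mu sigma : R).
Hypothesis mu0 : 0 < mu.
Hypothesis sigma0 : 0 < sigma.
Hypothesis s0 : s 0%N = 0.
Hypothesis s_nd : forall k, (0 < k)%N -> s k <= s k.+1.

(** A bound holding on every trajectory, ready to be integrated. The last sum [Q] acts as a Markov
    inequality: if [Q >= 1], the trivial bound [2 * M] is covered by [2 * M * Q]; if [Q < 1], all
    relative errors along [j^4] are below [eta]. The sum over the first indices sits under a minimum
    with [2 * M], since its logarithms need not be integrable. *)
Lemma infconv_le_logprod (L e eta G : R) (n i0 : nat) : 0 <= L -> 0 < e -> (0 < n)%N ->
  62 * eta <= 1 -> i0.+1%:R^-1 <= eta ->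
  G = mu / sigma / Num.sqrt n%:R ->
  infconv Phi L (cutint e (fun t => increment s mu sigma n (Num.truncn (n%:R * t)))) <=
  Phi (logprod s mu sigma n) +
  (Num.min (L * (G * \sum_(k < i0.+1 ^ 4)
      (`|ln (1 + relerr s mu k) - relerr s mu k| + 3 * `|relerr s mu k|))) (2 * M) +
   L * (G * (2 * (31 * eta))) + L * (G * (3 * (31 * eta) * \sum_(k < n.+1) `|relerr s mu k|)) +
   L * (qrt e * \sum_(k < n) `|increment s mu sigma n k| * (qrt n%:R / (k%:R * qrt k%:R))) +
   2 * M * \sum_(i < n.+2) `|s ((i0.+1 + i) ^ 4)%N - ((i0.+1 + i) ^ 4)%:R * mu|
                           / (eta * (((i0.+1 + i) ^ 4)%:R * mu))).
Proof.
move=> L0 e0 n0 eta62 i0e GE.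
have eta0 : 0 < eta by apply: lt_le_trans i0e; rewrite invr_gt0.
have M0 : 0 <= M := le_trans (normr_ge0 _) (PhiM (fun=> 0)).
set x := relerr s mu; set b := increment s mu sigma n.
set A : R := \sum_(k < i0.+1 ^ 4) _; set X : R := \sum_(k < n.+1) _.
set K : R := \sum_(k < n) _; set Q : R := \sum_(i < n.+2) _.
set z := logprod s mu sigma n.
set w := fun t => b (Num.truncn (n%:R * t)).
have G0 : 0 <= G by rewrite GE !divr_ge0 ?ltW// sqrtr_gt0 ltr0n.
have A0 : 0 <= A by apply: sumr_ge0 => k _; rewrite addr_ge0// mulr_ge0.
have X0 : 0 <= X by exact: sumr_ge0.
have K0 : 0 <= K.
  by apply: sumr_ge0 => k _; rewrite mulr_ge0// divr_ge0 ?qrt_ge0// mulr_ge0// qrt_ge0.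
have Qi0 i : 0 <= `|s ((i0.+1 + i) ^ 4)%N - ((i0.+1 + i) ^ 4)%:R * mu|
                           / (eta * (((i0.+1 + i) ^ 4)%:R * mu)).
  by rewrite divr_ge0// mulr_ge0 ?(ltW eta0)// mulr_ge0// ltW.
have Q0 : 0 <= Q by apply: sumr_ge0 => i _; exact: Qi0.
have wc : cadlag01 w by exact: cadlag01_step.
have hc : cadlag01 (cutint e w) by exact: cadlag01_cutint.
have zc : cadlag01 z by exact: cadlag01_logprod.
have h0 : 0 <= L * (G * (2 * (31 * eta))).
  by rewrite mulr_ge0// mulr_ge0//; lra.
have h1 : 0 <= L * (G * (3 * (31 * eta) * X)).
  by rewrite mulr_ge0// mulr_ge0// mulr_ge0//; lra.
have h3 : 0 <= L * (qrt e * K) by rewrite !mulr_ge0// qrt_ge0.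
have h4 : 0 <= 2 * M * Q by rewrite mulr_ge0//; lra.
have rough : infconv Phi L (cutint e w) <= Phi z + 2 * M.
  have := infconv_bound PhiM L0 hc; have := PhiM z.
  by rewrite !ler_norml => /andP[p1 p2] /andP[p3 p4]; lra.
have h2 : 0 <= Num.min (L * (G * A)) (2 * M).
  by rewrite le_min !mulr_ge0.
have [Q1|Q1] := leP 1 Q.
  have : 2 * M <= 2 * M * Q by rewrite ler_peMr//; lra.
  lra.
(* If the minimum equals [2 * M], the trivial bound suffices again; otherwise it is the first
   argument, exactly the cost of an [L]-Lipschitz step. *)
have [GA|GA] := leP (2 * M) (L * (G * A)).
  lra.
have good k : (i0.+1 ^ 4 <= k <= n)%N -> `|x k| <= 31 * eta.
  move=> kn; have k0 : (0 < k)%N.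
    by case/andP: kn => + _; apply: leq_trans; rewrite expn_gt0.
  have kmu : 0 < k%:R * mu by rewrite mulr_gt0// ltr0n.
  rewrite /x /relerr normrM [X in _ * X]ger0_norm ?invr_ge0 ?(ltW kmu)//.
  rewrite ler_pdivrMr//.
  apply: (@fourth_power_interpolation _ s mu eta i0.+1 n) => // j /andP[i0j jn].
  have jmu : 0 < eta * ((j ^ 4)%:R * mu).
    by rewrite mulr_gt0// mulr_gt0// ltr0n expn_gt0 (leq_trans _ i0j).
  rewrite -[leRHS]mul1r -ler_pdivrMr//; apply/ltW/(le_lt_trans _ Q1).
  have jE : j = (i0.+1 + (j - i0.+1))%N by rewrite subnKC.
  (* The interpolation also looks at the fourth power above [k], hence [j] up to [n.+1] and a sum of
     [n.+2] terms; each term is at most [Q < 1]. *)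
  rewrite {1 2 3}jE; apply: (@ler_bigterm _ n.+2 (j - i0.+1) (fun i =>
    `|s ((i0.+1 + i) ^ 4)%N - ((i0.+1 + i) ^ 4)%:R * mu|
      / (eta * (((i0.+1 + i) ^ 4)%:R * mu)))) => //.
  by rewrite ltnS (leq_trans (leq_subr _ _)).
have k0e : (i0.+1 ^ 4)%:R^-1 <= 31 * eta.
  have : (i0.+1 ^ 4)%:R^-1 <= i0.+1%:R^-1 :> R.
    rewrite lef_pV2 ?posrE ?ltr0n ?expn_gt0// ler_nat.
    by rewrite -{1}(expn1 i0.+1) leq_pexp2l.
  move=> /le_trans; apply; apply: le_trans i0e _; lra.
have h12 : 31 * eta <= 2^-1 by lra.
have k00 : (0 < i0.+1 ^ 4)%N by rewrite expn_gt0.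
have close := logprod_close mu0 sigma0 s0 n0 h12 k00 k0e good.
have inc0 : b 0%N = 0 by rewrite /b /increment s0 mul0r subrr mul0r.
have tail := cutint_tail wc (rho_step_le n0 inc0) e0.
rewrite -GE -/A -/X -/z in close; rewrite -/K in tail.
have hz : unif_le (cutint e w) z (qrt e * K + G * (A + 2 * (31 * eta) + 3 * (31 * eta) * X)).
  move=> t t01; have c1 := close t t01; have c2 := tail t t01.
  rewrite distrC; move: c1 c2; set i := Rint _ 0 t => c1 c2.
  have -> : z t - cutint e w t = (z t - i) + (i - cutint e w t) by ring.
  by apply: le_trans (ler_normD _ _) _; rewrite addrC lerD.
have X30 : 0 <= 3 * (31 * eta) * X by apply: mulr_ge0 => //; lra.
have c0 : 0 <= qrt e * K + G * (A + 2 * (31 * eta) + 3 * (31 * eta) * X).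
  apply: addr_ge0; first by rewrite mulr_ge0// qrt_ge0.
  apply: mulr_ge0 => //; lra.
have := infconv_le PhiM L0 zc c0 hz; lra.
Qed.

End pointwise.

(** * Expectations *)

Section expectation.
Context {R : realType} {d : measure_display} {T : measurableType d}.
Variable P : probability T R.
Implicit Types (f g : T -> R).

Lemma bounded_integrable f (K : R) : measurable_fun setT f ->
  (forall w, `|f w| <= K) -> P.-integrable setT (EFin \o f).
Proof.
move=> mf fK; apply: measurable_bounded_integrable => //.
  by rewrite /= probability_setT ltry.
exists K; split; first exact: num_real.
by move=> M KM w _; exact: le_trans (fK w) (ltW KM).
Qed.

Lemma bounded_integral_fin f (K : R) : measurable_fun setT f ->
  (forall w, `|f w| <= K) -> (\int[P]_w (f w)%:E = (\int[P]_w f w)%:E)%E.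
Proof.
move=> mf fK; rewrite fineK//.
exact: integrable_fin_num (bounded_integrable mf fK).
Qed.

Lemma bounded_convergence (F : nat -> T -> R) f (K : R) :
  (forall n, measurable_fun setT (F n)) -> measurable_fun setT f ->
  (forall n w, `|F n w| <= K) ->
  {ae P, forall w, (fun n => F n w) @ \oo --> f w} ->
  (fun n => \int[P]_w F n w) @ \oo --> \int[P]_w f w.
Proof.
move=> mF mf FK Ff.
have [|||||fi _ Hc] := @dominated_convergence _ _ _ P setT measurableT
  (fun n w => (F n w)%:E) (EFin \o f) (cst K%:E).
- by move=> n; exact/measurable_EFinP.
- exact/measurable_EFinP.
- apply: filterS Ff => w Fw _; apply: cvg_EFin => //.
  by apply: nearW.
- by apply: (@bounded_integrable (cst K) `|K|).
- by apply: aeW => w n _; rewrite /= lee_fin.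
apply: (@fine_cvg _ _ _ _ (fun n => (\int[P]_w (F n w)%:E)%E)).
by rewrite fineK; [exact: Hc|exact: integrable_fin_num fi].
Qed.

Lemma integral_lincomb (D : nat -> T -> R) (B c : nat -> R) (N : nat) :
  (forall k, measurable_fun setT (D k)) -> (forall k w, 0 <= D k w) ->
  (forall k, (\int[P]_w (D k w)%:E <= (B k)%:E)%E) -> (forall k, 0 <= c k) ->
  P.-integrable setT (EFin \o (fun w => \sum_(k < N) c k * D k w)) /\
  \int[P]_w (\sum_(k < N) c k * D k w) <= \sum_(k < N) c k * B k.
Proof.
move=> mD D0 DB c0.
have Di k : P.-integrable setT (EFin \o D k).
  apply/integrableP; split; first exact/measurable_EFinP.
  apply: le_lt_trans (ltry (B k)); apply: le_trans (DB k).
  apply: ge0_le_integral => //.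
  - by do 2 apply: measurableT_comp => //.
  - exact/measurable_EFinP.
  - by move=> w _ /=; rewrite lee_fin ger0_norm.
have DR k : \int[P]_w D k w <= B k.
  by rewrite -lee_fin fineK//; exact: integrable_fin_num (Di k).
have cDi k : P.-integrable setT (EFin \o (fun w => c k * D k w)).
  exact: (integrableZl _ (c k) (Di k)).
elim: N => [|N [IHi IHl]].
  split.
    rewrite (_ : _ \o _ = cst 0%E); first exact: integrable0.
    by apply/funext => w /=; rewrite big_ord0.
  rewrite big_ord0 (_ : (fun w => _) = cst 0) ?Rintegral_cst ?mul0r//.
  by apply/funext => w; rewrite big_ord0.
have E : (fun w => \sum_(k < N.+1) c k * D k w) =
    (fun w => \sum_(k < N) c k * D k w + c N * D N w).
  by apply/funext => w; rewrite big_ord_recr.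
rewrite E big_ord_recr/=; split; first exact: (integrableD _ IHi (cDi N)).
rewrite RintegralD// RintegralZl// lerD// ler_wpM2l//.
Qed.

End expectation.

Section functional_exp.
Context {R : realType}.

(** Near the bounded path [z] all values stay below [K + 1], where the exponential is Lipschitz with
    constant [expR (K + 1)]; uniform closeness implies Skorokhod closeness through the identity time
    change. *)
Lemma unif_continuous_at_expR (F : (R -> R) -> R) (z : R -> R) :
  skorokhod_continuous F -> cadlag01 z ->
  unif_continuous_at (fun y => F (fun t => expR (y t))) z.
Proof.
move=> Fc zc e e0.
have [dl dl0 Fd] := Fc _ (cadlag01_expR zc) e e0.
have [K K0 zK] := cadlag01_bounded zc.
pose h := Num.min 1 (dl / (2 * expR (K + 1))).
have E0 : 0 < expR (K + 1) :> R by exact: expR_gt0.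
have h0 : 0 < h by rewrite lt_min ltr01 divr_gt0// mulr_gt0.
have h1 : h <= 1 by rewrite ge_min lexx.
have hd : expR (K + 1) * h <= dl / 2.
  apply: le_trans (_ : expR (K + 1) * (dl / (2 * expR (K + 1))) <= _).
    by rewrite ler_pM2l// ge_min lexx orbT.
  by rewrite le_eqVlt; apply/orP; left; apply/eqP; field; rewrite gt_eqF.
have exp_lip (u v : R) : u <= K + 1 -> v <= K + 1 -> expR u - expR v <= expR (K + 1) * `|u - v|.
  move=> uK vK.
  have := expR_ge1Dx (v - u); rewrite expRB => H.
  have u0 := expR_gt0 u.
  have : expR u * (1 + (v - u)) <= expR v.
    by rewrite -ler_pdivlMl// mulrC.
  have : expR u * (u - v) <= expR u * `|u - v| by rewrite ler_pM2l// ler_norm.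
  have : expR u * `|u - v| <= expR (K + 1) * `|u - v| by rewrite ler_wpM2r// ler_expR.
  lra.
exists h => // y yc zy; apply/ltW/Fd; first exact: cadlag01_expR.
apply: (@skorokhod_lt_uniform _ _ _ (dl / 2)); [lra|lra|] => t t01.
have zt : z t <= K + 1 by have := zK t t01; rewrite ler_norml => /andP[_]; lra.
have zyt := zy t t01.
have yt : y t <= K + 1.
  have := zK t t01; have := zyt; rewrite !ler_norml => /andP[p1 p2] /andP[p3 p4]; lra.
apply: le_trans hd; apply: le_trans (_ : expR (K + 1) * `|z t - y t| <= _); last first.
  by rewrite ler_pM2l.
rewrite ler_norml; apply/andP; split; last exact: exp_lip.
by rewrite lerNl opprB distrC; exact: exp_lip.
Qed.

End functional_exp.

(** * Moment bounds for the partial-sum process *)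

Section partial_sums.
Context {R : realType} {d : measure_display} {Omega : measurableType d}.
Variables (P : probability Omega R) (S : nat -> Omega -> R) (mu sigma C : R).
Hypothesis mS : forall k, (0 < k)%N -> measurable_fun [set: Omega] (S k).
Hypothesis Snd : forall k w, (0 < k)%N -> S k w <= S k.+1 w.
Hypothesis mu0 : 0 < mu.
Hypothesis sigma0 : 0 < sigma.
Hypothesis SC : forall n, (0 < n)%N ->
     (\int[P]_w (`|S n w - n%:R * mu|)%:E <= (C * Num.sqrt n%:R)%:E)%E.

Definition S_at w k := S0ext S k w.
Definition absdev k w := `|S_at w k - k%:R * mu|.
Definition Xpath n w (t : R) := increment (S_at w) mu sigma n (Num.truncn (n%:R * t)).

Lemma measurable_S_at k : measurable_fun [set: Omega] (fun w => S_at w k).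
Proof. by case: k => [|k]; [exact: measurable_cst|exact: mS]. Qed.

Lemma measurable_absdev k : measurable_fun [set: Omega] (absdev k).
Proof.
apply: measurableT_comp => //; apply: measurable_funB => //.
exact: measurable_S_at.
Qed.

Lemma absdev_ge0 k w : 0 <= absdev k w. Proof. exact: normr_ge0. Qed.

Lemma integral_absdev k : (\int[P]_w (absdev k w)%:E <= (C * Num.sqrt k%:R)%:E)%E.
Proof.
case: k => [|k]; last exact: SC.
rewrite sqrtr0 mulr0 (_ : (fun w => _) = cst 0%E) ?integral0//.
by apply/funext => w; rewrite /absdev /S_at /= mul0r subrr normr0.
Qed.

Lemma C_ge0 : 0 <= C.
Proof.
rewrite -[C]mulr1 -sqrtr1 -lee_fin; apply: le_trans (SC (ltn0Sn 0)).
by apply: integral_ge0 => w _; rewrite lee_fin.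
Qed.

Lemma measurable_increment n k :
  measurable_fun [set: Omega] (fun w => increment (S_at w) mu sigma n k).
Proof.
apply: measurable_funM => //; apply: measurable_funB => //.
exact: measurable_S_at.
Qed.

Lemma measurable_relerr k : measurable_fun [set: Omega] (fun w => relerr (S_at w) mu k).
Proof.
apply: measurable_funM => //; apply: measurable_funB => //.
exact: measurable_S_at.
Qed.

Lemma cadlag01_Xpath n w : cadlag01 (Xpath n w).
Proof. exact: (cadlag01_step (increment (S_at w) mu sigma n) n). Qed.

Lemma measurable_Xpath_functional n (f : (R -> R) -> R) : skorokhod_continuous f ->
  measurable_fun [set: Omega] (fun w => f (Xpath n w)).
Proof.
move=> fc; apply: (measurable_functional_step (b := fun k w => increment (S_at w) mu sigma n k)) => // k.
exact: measurable_increment.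
Qed.

Lemma sqrtn_gt0 (n : nat) : (0 < n)%N -> 0 < Num.sqrt n%:R :> R.
Proof. by move=> n0; rewrite sqrtr_gt0 ltr0n. Qed.

Lemma weighted_absdev_bound (n : nat) (a : R) : (0 < n)%N -> 0 <= a ->
  let U w := a * \sum_(k < n) `|increment (S_at w) mu sigma n k| * (qrt n%:R / (k%:R * qrt k%:R)) in
  P.-integrable setT (EFin \o U) /\ \int[P]_w U w <= a * (4 * C / sigma).
Proof.
move=> n0 a0 U; have rn := sqrtn_gt0 n0.
pose c k : R := a * ((qrt n%:R / (k%:R * qrt k%:R)) / (sigma * Num.sqrt n%:R)).
have c0 k : 0 <= c k.
  apply: mulr_ge0 => //; apply: divr_ge0; last by rewrite mulr_ge0 ?(ltW sigma0)// ltW.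
  by apply: divr_ge0; rewrite ?mulr_ge0 ?qrt_ge0.
have -> : U = fun w => \sum_(k < n) c k * absdev k w.
  apply/funext => w; rewrite /U mulr_sumr; apply: eq_bigr => k _.
  rewrite /c /increment normrM -/(absdev k w) [`|_^-1|]ger0_norm ?invr_ge0 ?mulr_ge0 ?(ltW sigma0) ?(ltW rn)//.
  ring.
have [Ui Ul] := integral_lincomb n measurable_absdev absdev_ge0 integral_absdev c0.
split => //; apply: le_trans Ul _.
have -> : \sum_(k < n) c k * (C * Num.sqrt k%:R) = a * (C / sigma / Num.sqrt n%:R *
    \sum_(k < n) Num.sqrt k%:R * (qrt n%:R / (k%:R * qrt k%:R))).
  rewrite !mulr_sumr; apply: eq_bigr => k _; rewrite /c !invfM; ring.
rewrite ler_wpM2l//.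
apply: le_trans (ler_wpM2l _ (sum_qrt_div_le n)) _.
  by rewrite !divr_ge0 ?C_ge0 ?(ltW sigma0)// ltW.
rewrite le_eqVlt; apply/orP; left; apply/eqP; field.
by rewrite !gt_eqF.
Qed.

(** The bound depends on none of [n], [e] and [M], so it survives the passage to the limit process
    and the removal of cut-off and truncation. *)
Lemma integral_rho_le (n : nat) (e M : R) : (0 < n)%N -> 0 < e -> 0 <= M ->
  \int[P]_w Num.min M (rho e (Xpath n w)) <= 4 * C / sigma.
Proof.
move=> n0 e0 M0.
have [Ui Ul] := weighted_absdev_bound n0 ler01.
rewrite mul1r in Ul; apply: le_trans Ul.
apply: le_Rintegral => //.
  apply: (@bounded_integrable _ _ _ P _ M).
    apply: (@measurable_Xpath_functional n (fun x => Num.min M (rho e x))).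
    exact: skorokhod_continuous_rho.
  by move=> w; rewrite ger0_norm ?ge_min ?lexx// le_min M0 rho_ge0.
move=> w _; rewrite mul1r ge_min; apply/orP; right.
apply: rho_step => //.
by rewrite /increment /S_at /= mul0r subrr mul0r.
Qed.

Section comparison.
Variables (Phi : (R -> R) -> R) (M : R).
Hypothesis PhiM : forall x, `|Phi x| <= M.
Hypothesis mPhi : forall n, measurable_fun [set: Omega]
  (fun w => Phi (logprod (S_at w) mu sigma n)).

(** The pathwise bound is integrated term by term. The cut-off term is kept in the statement. One
    third of [eps] goes to the truncated initial sum, one to the terms proportional to [eta], one to
    the Markov sum; [eta] and [i0] are fixed before [n] grows. *)
Lemma smoothed_le_eventually (L e eps : R) : 0 <= L -> 0 < e -> 0 < eps ->
  \forall n \near \oo,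
    \int[P]_w smoothed Phi L e (Xpath n w) <=
    \int[P]_w Phi (logprod (S_at w) mu sigma n) + L * qrt e * (4 * C / sigma) + eps.
Proof.
move=> L0 e0 eps0.
have C0 := C_ge0.
have M0 : 0 <= M := le_trans (normr_ge0 _) (PhiM (fun=> 0)).
have eps3 : 0 < eps / 3 by rewrite divr_gt0.
(* [q * eta] bounds the two terms proportional to [eta]: [2 * mu] stems from [u2], and [6 * C] from
   [U3], by the factors 3 of [linearization_error] and 2 of [sum_sqrt_div_le]. *)
pose q : R := 31 * L * (2 * mu + 6 * C) / sigma.
have q0 : 0 <= q.
  rewrite divr_ge0 ?(ltW sigma0)// mulr_ge0//; first by rewrite mulr_ge0.
  by rewrite addr_ge0// mulr_ge0// ltW.
(* [62 = 2 * 31]: interpolation inflates [eta] to [31 * eta], which has to stay below 1/2 for the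
   linearization of [ln]. *)
pose eta := Num.min 62^-1 (eps / 3 / (q + 1)).
have eta0 : 0 < eta.
  by rewrite lt_min invr_gt0 ltr0n/= divr_gt0//; lra.
have eta62 : 62 * eta <= 1.
  have : eta <= 62^-1 by rewrite ge_min lexx.
  lra.
have etaq : q * eta <= eps / 3.
  have e1 : eta <= eps / 3 / (q + 1) by rewrite ge_min lexx orbT.
  apply: le_trans (ler_wpM2l q0 e1) _.
  rewrite mulrCA -[leRHS]mulr1 ler_pM2l// ler_pdivrMr; lra.
(* Any [i0] above [bd] satisfies both [1 / i0.+1 <= eta] and the bound [eps / 3] for the Markov
   sum. *)
pose bd := eta^-1 + 2 * M * C / (eta * mu) / (eps / 3).
have bd0 : 0 <= 2 * M * C / (eta * mu) / (eps / 3).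
  by rewrite !divr_ge0 ?mulr_ge0// ltW// mulr_gt0.
pose i0 := (Num.truncn bd).+1.
have bdi : bd < i0%:R by exact: truncnS_gt.
have i0R : 0 < i0%:R :> R by rewrite ltr0n.
have i0e : i0.+1%:R^-1 <= eta.
  rewrite -[leRHS]invrK lef_pV2 ?posrE ?invr_gt0//.
  apply: le_trans (_ : i0%:R <= _); last by rewrite ler_nat.
  apply/ltW; apply: le_lt_trans bdi; rewrite /bd; lra.
have i0M : 2 * M * C / (eta * mu) * i0%:R^-1 <= eps / 3.
  rewrite ler_pdivrMr// [leRHS]mulrC -ler_pdivrMr//; apply/ltW.
  apply: le_lt_trans bdi; rewrite /bd lerDr invr_ge0; exact: ltW.
pose G n : R := mu / sigma / Num.sqrt n%:R.
pose A w : R := \sum_(k < i0.+1 ^ 4)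
  (`|ln (1 + relerr (S_at w) mu k) - relerr (S_at w) mu k| + 3 * `|relerr (S_at w) mu k|).
pose U1 n w := Num.min (L * (G n * A w)) (2 * M).
have mA : measurable_fun setT A.
  apply: measurable_sum => k; apply: measurable_funD.
    apply: measurableT_comp => //; apply: measurable_funB; last exact: measurable_relerr.
    apply: measurableT_comp; first exact: measurable_ln.
    by apply: measurable_funD => //; exact: measurable_relerr.
  by apply: measurable_funM => //; apply: measurableT_comp => //; exact: measurable_relerr.
have A0 w : 0 <= A w by apply: sumr_ge0 => k _; rewrite addr_ge0// mulr_ge0.
have G0 n : 0 <= G n by rewrite !divr_ge0 ?sqrtr_ge0// ltW.
have mU1 n : measurable_fun setT (U1 n).
  by apply: measurable_minr => //; apply: measurable_funM => //; exact: measurable_funM.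
have U10 n w : 0 <= U1 n w.
  rewrite le_min; apply/andP; split; last exact: mulr_ge0.
  by apply: mulr_ge0 => //; exact: mulr_ge0.
have U1b n w : `|U1 n w| <= 2 * M by rewrite ger0_norm// ge_min lexx orbT.
(* [A w] is finite and does not depend on [n] while [G n] tends to 0; the minimum with [2 * M]
   supplies the domination. *)
have U1c : (fun n => \int[P]_w U1 n w) @ \oo --> (0 : R).
  have -> : 0 = \int[P]_w (cst 0 w) :> R by rewrite Rintegral_cst ?mul0r.
  apply: (bounded_convergence (K := 2 * M)) => //.
  apply: aeW => w.
  apply: (@squeeze_cvgr _ _ _ _ (cst 0) (fun n => L * (G n * A w))).
  - by apply: nearW => n; rewrite U10 ge_min lexx.
  - exact: cvg_cst.
  - have -> : (0 : R) = L * (mu / sigma * 0 * A w) by ring.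
    apply: cvgM; first exact: cvg_cst.
    apply: cvgM; last exact: cvg_cst.
    apply: cvgM; first exact: cvg_cst.
    apply/gtr0_cvgV0.
      by near=> n; apply: sqrtn_gt0; near: n; exact: nbhs_infty_gt.
    apply/cvgryPge => K; near=> n.
    rewrite (le_trans (ler_norm K))// -sqrtr_sqr ler_wsqrtr//.
    by near: n; exact: nbhs_infty_ger.
near=> n.
have n0 : (0 < n)%N by near: n; exact: nbhs_infty_gt.
have rn := sqrtn_gt0 n0.
have EU1 : \int[P]_w U1 n w <= eps / 3.
  near: n; move/cvgr0Pnorm_le : U1c => /(_ _ eps3); apply: filterS => n.
  by apply: le_trans; exact: ler_norm.
have U1i : P.-integrable setT (EFin \o U1 n) := bounded_integrable P (mU1 n) (U1b n).
pose u2 := L * (G n * (2 * (31 * eta))).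
have u2le : u2 <= 31 * L * (2 * mu) / sigma * eta.
  have -> : u2 = 31 * L * (2 * mu) / sigma * eta * (Num.sqrt n%:R)^-1.
    by rewrite /u2 /G; ring.
  rewrite ler_piMr//.
    rewrite mulr_ge0 ?(ltW eta0)// divr_ge0 ?(ltW sigma0)//.
    by rewrite mulr_ge0// mulr_ge0// ltW.
  by rewrite invf_le1// -[leLHS]sqrtr1 ler_wsqrtr// ler1n.
pose c3 k : R := L * (G n * (3 * (31 * eta))) / (k%:R * mu).
have h0 : 0 <= L * (G n * (3 * (31 * eta))).
  by apply: mulr_ge0 => //; apply: mulr_ge0 => //; lra.
have c30 k : 0 <= c3 k by apply: divr_ge0 => //; rewrite mulr_ge0// ltW.
have [U3i U3l] := integral_lincomb n.+1 measurable_absdev absdev_ge0 integral_absdev c30.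
set U3 := (fun w => \sum_(k < n.+1) c3 k * absdev k w) in U3i U3l.
have {}U3l : \int[P]_w U3 w <= 31 * L * (6 * C) / sigma * eta.
  apply: le_trans U3l _.
  have -> : \sum_(k < n.+1) c3 k * (C * Num.sqrt k%:R) =
      (L * (G n * (3 * (31 * eta))) * C / mu) * \sum_(k < n.+1) Num.sqrt k%:R / k%:R.
    rewrite mulr_sumr; apply: eq_bigr => k _; rewrite /c3 !invfM; ring.
  apply: le_trans (ler_wpM2l _ (sum_sqrt_div_le n)) _.
    by rewrite divr_ge0 ?(ltW mu0)// mulr_ge0.
  rewrite le_eqVlt; apply/orP; left; apply/eqP; rewrite /G; field.
  by rewrite !gt_eqF.
have Le0 : 0 <= L * qrt e by rewrite mulr_ge0// qrt_ge0.
have [U4i U4l] := weighted_absdev_bound n0 Le0.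
set U4 := (fun w => L * qrt e * _) in U4i U4l.
pose c5 i : R := 2 * M / (eta * (((i0.+1 + i) ^ 4)%:R * mu)).
have M20 : 0 <= 2 * M by exact: mulr_ge0.
have c50 i : 0 <= c5 i.
  by apply: divr_ge0 => //; rewrite mulr_ge0 ?(ltW eta0)// mulr_ge0// ltW.
have [U5i U5l] := integral_lincomb n.+2 (fun i => measurable_absdev ((i0.+1 + i) ^ 4))
  (fun i => absdev_ge0 ((i0.+1 + i) ^ 4)) (fun i => integral_absdev ((i0.+1 + i) ^ 4)) c50.
set U5 := (fun w => \sum_(k < n.+2) c5 k * absdev _ w) in U5i U5l.
have {}U5l : \int[P]_w U5 w <= eps / 3.
  apply: le_trans U5l _; apply: le_trans i0M.
  have -> : \sum_(i < n.+2) c5 i * (C * Num.sqrt ((i0.+1 + i) ^ 4)%:R) =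
      2 * M * C / (eta * mu) *
      \sum_(i < n.+2) Num.sqrt ((i0.+1 + i) ^ 4)%:R / ((i0.+1 + i) ^ 4)%:R.
    rewrite mulr_sumr; apply: eq_bigr => i _; rewrite /c5 !invfM; ring.
  rewrite ler_wpM2l//; last exact: sum_inv_sqr_le.
  by apply: divr_ge0; [exact: mulr_ge0|rewrite ltW// mulr_gt0].
pose V w := U1 n w + u2 + U3 w + U4 w + U5 w.
have u2i : P.-integrable setT (EFin \o cst u2) by apply: (@bounded_integrable _ _ _ P _ `|u2|).
have V1i : P.-integrable setT (EFin \o (fun w => U1 n w + u2)) by exact: (integrableD _ U1i u2i).
have V2i : P.-integrable setT (EFin \o (fun w => U1 n w + u2 + U3 w)) by exact: (integrableD _ V1i U3i).
have V3i : P.-integrable setT (EFin \o (fun w => U1 n w + u2 + U3 w + U4 w)) by exact: (integrableD _ V2i U4i).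
have Vi : P.-integrable setT (EFin \o V) by exact: (integrableD _ V3i U5i).
have VE : \int[P]_w V w = \int[P]_w U1 n w + u2 + \int[P]_w U3 w + \int[P]_w U4 w + \int[P]_w U5 w.
  rewrite RintegralD// RintegralD// RintegralD// RintegralD//.
  by rewrite Rintegral_cst//= probability_setT mulr1.
have Phii : P.-integrable setT (EFin \o (fun w => Phi (logprod (S_at w) mu sigma n))).
  exact: (bounded_integrable P (mPhi n) (fun w => PhiM _)).
apply: (@le_trans _ _ (\int[P]_w (Phi (logprod (S_at w) mu sigma n) + V w))); last first.
  rewrite RintegralD// VE.
  have -> : eps = eps / 3 + eps / 3 + eps / 3 by field.
  have : q * eta = 31 * L * (2 * mu) / sigma * eta + 31 * L * (6 * C) / sigma * eta.
    by rewrite /q; ring.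
  lra.
apply: le_Rintegral => //.
- apply: (@bounded_integrable _ _ _ P _ M).
    apply: (@measurable_Xpath_functional n (smoothed Phi L e)).
    exact: (skorokhod_continuous_smoothed PhiM L0 e0).
  by move=> w; exact: smoothed_bound.
- exact: (integrableD _ Phii Vi).
move=> w _; rewrite smoothedE; last exact: cadlag01_Xpath.
have s_nd k : (0 < k)%N -> S_at w k <= S_at w k.+1 by case: k => // k _; exact: Snd.
have := infconv_le_logprod PhiM mu0 sigma0 erefl s_nd L0 e0 n0 eta62 i0e erefl.
move=> /le_trans; apply; rewrite lerD2l /V.
have -> : L * (G n * (3 * (31 * eta) * \sum_(k < n.+1) `|relerr (S_at w) mu k|)) = U3 w.
  rewrite /U3 !mulr_sumr; apply: eq_bigr => k _.
  rewrite /c3 /relerr normrM -/(absdev k w) [`|_^-1|]ger0_norm ?invr_ge0 ?mulr_ge0 ?(ltW mu0)//.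
  ring.
have -> : 2 * M * \sum_(i < n.+2) `|S_at w ((i0.+1 + i) ^ 4)%N - ((i0.+1 + i) ^ 4)%:R * mu|
   / (eta * (((i0.+1 + i) ^ 4)%:R * mu)) = U5 w.
  rewrite /U5 mulr_sumr; apply: eq_bigr => i _; rewrite /c5 /absdev; ring.
by rewrite [L * (qrt e * _)]mulrA.
Unshelve. all: by end_near. Qed.

End comparison.
End partial_sums.

(** * The limit process *)

Section limit_process.
Context {R : realType} {d : measure_display} {Omega : measurableType d}.
Variables (P : probability Omega R) (W : R -> Omega -> R).
Hypothesis mW : forall t, 0 <= t -> measurable_fun [set: Omega] (W t).
Hypothesis Wc : forall w, {within `[0, +oo[, continuous (fun t => W t w)}.

Definition Wpath w t := W t w.

Lemma cadlag01_Wpath w : cadlag01 (Wpath w).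
Proof. by apply/unif_continuous_cadlag01/within_continuous_unif; exact: Wc. Qed.

Lemma measurable_Wpath_functional (f : (R -> R) -> R) : skorokhod_continuous f ->
  measurable_fun [set: Omega] (fun w => f (Wpath w)).
Proof.
move=> fc; apply: measurable_functional_continuous => // t /andP[t0 _].
exact: mW.
Qed.

Lemma rho_nd (x : R -> R) (m n : nat) : cadlag01 x -> (m <= n)%N ->
  rho m.+1%:R^-1 x <= rho n.+1%:R^-1 x.
Proof.
move=> xc mn; apply: le_Rint => //; try by apply/bmf01_int01/bmf01_rho => //; rewrite invr_gt0.
by move=> s _; rewrite ler_wpM2l//; apply: (cutoff_nd s decreasing_tail_weight) mn.
Qed.

(** Cut-off and truncation level share the index [m], so the functionals increase in [m]. Their
    limit has finite integral by monotone convergence, hence is finite almost everywhere. *)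
Lemma ae_rho_bounded (K0 : R) :
  (forall m : nat, \int[P]_w Num.min m%:R (rho m.+1%:R^-1 (Wpath w)) <= K0) ->
  {ae P, forall w, exists K : R, forall m : nat, rho m.+1%:R^-1 (Wpath w) <= K}.
Proof.
move=> HK; pose psi (m : nat) w := Num.min m%:R (rho m.+1%:R^-1 (Wpath w)).
have mpsi m : measurable_fun setT (psi m).
  apply: (@measurable_Wpath_functional (fun x => Num.min m%:R (rho m.+1%:R^-1 x))).
  by apply: skorokhod_continuous_rho; rewrite invr_gt0.
have psi0 m w : 0 <= psi m w by rewrite le_min rho_ge0 andbT.
have psib m w : `|psi m w| <= m%:R by rewrite ger0_norm// ge_min lexx.
have psi_nd w : nondecreasing_seq (fun m => (psi m w)%:E).
  move=> m n mn; rewrite lee_fin le_min; apply/andP; split.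
    by rewrite ge_min ler_nat mn.
  by rewrite ge_min rho_nd ?orbT//; exact: cadlag01_Wpath.
pose g w := limn (fun m => (psi m w)%:E).
have psile w m : ((psi m w)%:E <= g w)%E.
  rewrite /g (cvg_lim _ (ereal_nondecreasing_cvgn (psi_nd w)))//.
  by apply: ereal_sup_ubound; exists m.
have mg : measurable_fun setT g.
  apply: (emeasurable_fun_cvg (fun m w => (psi m w)%:E)).
    by move=> m; exact/measurable_EFinP.
  by move=> w _; exact: ereal_nondecreasing_is_cvgn.
have g0 w : (0 <= g w)%E by apply: le_trans (psile w 0%N); rewrite lee_fin.
have gi : P.-integrable setT g.
  apply/integrableP; split => //.
  apply: le_lt_trans (ltry K0).
  have -> : (\int[P]_w `|g w| = \int[P]_w g w)%E.
    by apply: eq_integral => w _; rewrite gee0_abs.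
  rewrite monotone_convergence; last 4 first.
  - exact: measurableT.
  - by move=> m; exact/measurable_EFinP.
  - by move=> m w _; rewrite lee_fin.
  - by move=> w _; exact: psi_nd.
  apply: lime_le.
    apply: ereal_nondecreasing_is_cvgn => m n mn; apply: ge0_le_integral => //.
    - by move=> w _; rewrite lee_fin.
    - exact/measurable_EFinP.
    - exact/measurable_EFinP.
    - by move=> w _; exact: psi_nd.
  apply: nearW => m; rewrite (bounded_integral_fin P (mpsi m) (psib m)) lee_fin.
  exact: HK.
have := integrable_ae measurableT gi; apply: filterS => w /(_ Logic.I) gw.
exists (fine (g w)) => m.
have psiK (n : nat) : psi n w <= fine (g w) by rewrite -lee_fin fineK.
(* At a level above [fine (g w)] the minimum cannot be the truncation, so it is [rho] itself that is
   bounded. *)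
pose n := maxn m (Num.truncn (fine (g w))).+1.
have gn : fine (g w) < n%:R.
  by apply: lt_le_trans (truncnS_gt _) _; rewrite ler_nat leq_maxr.
apply: le_trans (rho_nd (cadlag01_Wpath w) (leq_maxl m (Num.truncn (fine (g w))).+1)) _.
have := psiK n; rewrite /psi ge_min -/n => /orP[|//].
by rewrite leNgt gn.
Qed.

(** Cut-off paired with the Lipschitz constant [m]: its fourth root is [m.+1 ^ (-2)], so that
    [m * qrt (scale m)] tends to 0. *)
Definition scale (m : nat) : R := (m.+1%:R^-1 ^+ 2) ^+ 4.

Lemma scale_gt0 m : 0 < scale m.
Proof. by rewrite /scale !exprn_gt0// invr_gt0. Qed.

Lemma qrt_scale m : qrt (scale m) = m.+1%:R^-1 ^+ 2.
Proof. by rewrite /scale qrtK// exprn_ge0// invr_ge0. Qed.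

Lemma mul_qrt_scale m : m%:R * qrt (scale m) <= m.+1%:R^-1.
Proof.
rewrite qrt_scale expr2 mulrA ler_piMl ?invr_ge0//.
by rewrite ler_pdivrMr ?ltr0n// mul1r ler_nat.
Qed.

(** For almost every path [cutint_tail] gives uniform convergence at the rate [qrt (scale m) * K],
    and [infconv_cvg] applies with Lipschitz constant [m]. The constant [K] depends on the path,
    which is harmless under bounded convergence. *)
Lemma cvg_smoothed_limit (F : (R -> R) -> R) (M : R) :
  (forall x, `|F x| <= M) -> skorokhod_continuous F ->
  measurable_fun [set: Omega]
    (fun w => F (fun t => expR (Rint (fun r => Wpath w r / r) 0 t))) ->
  {ae P, forall w, exists K : R, forall m : nat, rho m.+1%:R^-1 (Wpath w) <= K} ->
  (fun m => \int[P]_w smoothed (fun z => F (fun t => expR (z t))) m%:R (scale m) (Wpath w))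
    @ \oo --> \int[P]_w F (fun t => expR (Rint (fun r => Wpath w r / r) 0 t)).
Proof.
move=> FM Fc mF WK; pose Phi z := F (fun t => expR (z t)).
have PhiM z : `|Phi z| <= M by exact: FM.
apply: (bounded_convergence (K := M)) => //.
- move=> m; apply: (@measurable_Wpath_functional (smoothed Phi m%:R (scale m))).
  by apply: (skorokhod_continuous_smoothed PhiM); [|exact: scale_gt0].
- by move=> m w; apply: smoothed_bound => //; exact: scale_gt0.
apply: filterS WK => w [K rK].
have wc := cadlag01_Wpath w.
have K0 : 0 <= K := le_trans (rho_ge0 _ _) (rK 0%N).
have zc := cadlag01_Rint_div wc rK.
set z := fun t => Rint _ 0 t in zc *.
rewrite (_ : (fun m : nat => _) = (fun m => infconv Phi m%:R (cutint (scale m) (Wpath w)))); last first.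
  by apply/funext => m; rewrite smoothedE.
apply: (@infconv_cvg _ Phi M PhiM (fun m => m%:R) (fun m => qrt (scale m) * K)
  (fun m => cutint (scale m) (Wpath w)) z).
- exact: unif_continuous_at_expR.
- exact: zc.
- by move=> m; apply: cadlag01_cutint => //; exact: scale_gt0.
- by move=> m; rewrite ler0n.
- by move=> m; rewrite mulr_ge0// qrt_ge0.
- by move=> m; apply: cutint_tail => //; exact: scale_gt0.
- exact: cvgr_idn.
- suff H : (fun m => qrt (scale m) * K) @ \oo --> 0 * K by rewrite mul0r in H.
  apply: cvgM; last exact: cvg_cst.
  under eq_fun do rewrite qrt_scale expr2.
  suff H : (fun m : nat => m.+1%:R^-1 * m.+1%:R^-1 : R) @ \oo --> 0 * (0 : R).
    by rewrite mul0r in H.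
  by apply: cvgM; exact: cvg_harmonic.
- suff H : (fun m : nat => m%:R * qrt (scale m) * K) @ \oo --> 0 * K.
    by rewrite mul0r in H; under eq_fun do rewrite mulrA.
  apply: cvgM; last exact: cvg_cst.
  apply: (@squeeze_cvgr _ _ _ _ (cst 0) (fun m => m.+1%:R^-1)).
  + by apply: nearW => m; rewrite mul_qrt_scale andbT mulr_ge0// qrt_ge0.
  + exact: cvg_cst.
  + exact: cvg_harmonic.
Qed.

End limit_process.

Lemma conv_in_distr_D_real {R : realType} {d1 d2 : measure_display}
  {Omega1 : measurableType d1} {Omega2 : measurableType d2}
  (P1 : probability Omega1 R) (X : nat -> Omega1 -> R -> R)
  (P2 : probability Omega2 R) (Y : Omega2 -> R -> R) (f : (R -> R) -> R) (M : R) :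
  conv_in_distr_D P1 X P2 Y -> (forall x, `|f x| <= M) -> skorokhod_continuous f ->
  (forall n, measurable_fun [set: Omega1] (fun w => f (X n w))) ->
  measurable_fun [set: Omega2] (fun w => f (Y w)) ->
  (fun n => \int[P1]_w f (X n w)) @ \oo --> \int[P2]_w f (Y w).
Proof.
move=> XY fM fc mX mY.
have fb : bounded_functional f by exists M.
have := XY f fb fc mX mY; rewrite (bounded_integral_fin P2 mY (fun w => fM _)).
exact: fine_cvg.
Qed.

(** * The one-sided limit inequality *)

Section lower_bound.
Context {R : realType} {d d' : measure_display}
  {Omega : measurableType d} {Omega' : measurableType d'}.
Variables (P : probability Omega R) (P' : probability Omega' R).
Variables (S : nat -> Omega -> R) (W : R -> Omega' -> R) (mu sigma C : R).
Hypothesis mS : forall k, (0 < k)%N -> measurable_fun [set: Omega] (S k).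
Hypothesis Snd : forall k w, (0 < k)%N -> S k w <= S k.+1 w.
Hypothesis mu0 : 0 < mu.
Hypothesis sigma0 : 0 < sigma.
Hypothesis SC : forall n, (0 < n)%N ->
     (\int[P]_w (`|S n w - n%:R * mu|)%:E <= (C * Num.sqrt n%:R)%:E)%E.
Hypothesis mW : forall t, 0 <= t -> measurable_fun [set: Omega'] (W t).
Hypothesis Wc : forall w, {within `[0, +oo[, continuous (fun t => W t w)}.
Hypothesis XW : conv_in_distr_D P (Xpath S mu sigma) P' (Wpath W).

(** For each [m] the truncated [rho] is an admissible test functional, so its expectation under the
    limit is the limit of expectations all bounded by [4 * C / sigma]. *)
Lemma ae_rho_Wpath_bounded :
  {ae P', forall w, exists K : R, forall m : nat, rho m.+1%:R^-1 (Wpath W w) <= K}.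
Proof.
apply: (@ae_rho_bounded _ _ _ P' W mW Wc (4 * C / sigma)) => m.
have m0 : 0 < m.+1%:R^-1 :> R by rewrite invr_gt0.
have fc : skorokhod_continuous (fun x => Num.min m%:R (rho (m.+1%:R^-1 : R) x)).
  exact: skorokhod_continuous_rho.
have fb x : `|Num.min m%:R (rho (m.+1%:R^-1 : R) x)| <= m%:R.
  by rewrite ger0_norm ?ge_min ?lexx// le_min rho_ge0 ler0n.
have mX n := measurable_Xpath_functional mu sigma mS n fc.
have mWf := measurable_Wpath_functional mW Wc fc.
have cv := conv_in_distr_D_real XW fb fc mX mWf.
rewrite -(cvg_lim _ cv)//; apply: limr_le; first exact: cvgP cv.
near=> n; apply: integral_rho_le => //.
by near: n; exact: nbhs_infty_gt.
Unshelve. all: by end_near. Qed.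

(** Four errors of [eps / 4]: replacing the limit functional by its smoothing, convergence in
    distribution for that smoothing, the cut-off along the partial sums, and the comparison with the
    log-product. The index [m] is fixed first and [n] grows afterwards. *)
Lemma integral_lower_bound (F : (R -> R) -> R) (M eps : R) :
  (forall x, `|F x| <= M) -> skorokhod_continuous F ->
  (forall n, measurable_fun [set: Omega]
    (fun w => F (fun t => expR (logprod (S_at S w) mu sigma n t)))) ->
  measurable_fun [set: Omega']
    (fun w => F (fun t => expR (Rint (fun r => Wpath W w r / r) 0 t))) ->
  0 < eps -> \forall n \near \oo,
    \int[P']_w F (fun t => expR (Rint (fun r => Wpath W w r / r) 0 t)) <=
    \int[P]_w F (fun t => expR (logprod (S_at S w) mu sigma n t)) + eps.
Proof.
move=> FM Fc mX mY eps0.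
have eps4 : 0 < eps / 4 by rewrite divr_gt0.
pose Phi z := F (fun t => expR (z t)).
have PhiM z : `|Phi z| <= M by exact: FM.
have C0 := C_ge0 SC.
have lim := cvg_smoothed_limit mW Wc FM Fc mY ae_rho_Wpath_bounded.
have [m [Fm em]] : exists m : nat,
    \int[P']_w Phi (fun t => Rint (fun r => Wpath W w r / r) 0 t) <=
      \int[P']_w smoothed Phi m%:R (scale m) (Wpath W w) + eps / 4 /\
    m%:R * qrt (scale m) * (4 * C / sigma) <= eps / 4.
  have [N _ HN] : \forall m \near \oo,
    \int[P']_w Phi (fun t => Rint (fun r => Wpath W w r / r) 0 t) <=
      \int[P']_w smoothed Phi m%:R (scale m) (Wpath W w) + eps / 4 /\
    m%:R * qrt (scale m : R) * (4 * C / sigma) <= eps / 4.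
    have K0 : 0 <= 4 * C / sigma by rewrite divr_ge0 ?mulr_ge0// ltW.
    pose c := eps / 4 / (4 * C / sigma + 1).
    have c0 : 0 < c by rewrite divr_gt0//; lra.
    near=> m; split.
      near: m; move/cvgrPdist_le : lim => /(_ _ eps4); apply: filterS => m.
      by rewrite ler_norml => /andP[_]; rewrite lerBlDl addrC.
    apply: le_trans (ler_wpM2r K0 (mul_qrt_scale m)) _.
    apply: le_trans (_ : c * (4 * C / sigma) <= _).
      rewrite ler_wpM2r//; apply/ltW.
      by near: m; exact: (near_infty_natSinv_lt (PosNum c0)).
    rewrite /c -mulrA -[leRHS]mulr1 ler_pM2l// mulrC ler_pdivrMr; lra.
  by exists N; exact: (HN N (leqnn N)).
have fc : skorokhod_continuous (smoothed Phi m%:R (scale m)).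
  by apply: (skorokhod_continuous_smoothed PhiM); [|exact: scale_gt0].
have fb x : `|smoothed Phi m%:R (scale m) x| <= M.
  by apply: smoothed_bound => //; exact: scale_gt0.
have mXf n := measurable_Xpath_functional mu sigma mS n fc.
have mWf := measurable_Wpath_functional mW Wc fc.
have /cvgrPdist_le cX := conv_in_distr_D_real XW fb fc mXf mWf.
near=> n.
have H1 : \int[P']_w smoothed Phi m%:R (scale m) (Wpath W w) <=
    \int[P]_w smoothed Phi m%:R (scale m) (Xpath S mu sigma n w) + eps / 4.
  near: n; have := cX _ eps4; apply: filterS => n.
  by rewrite ler_norml => /andP[_]; rewrite lerBlDl addrC.
have H2 : \int[P]_w smoothed Phi m%:R (scale m) (Xpath S mu sigma n w) <=
    \int[P]_w Phi (logprod (S_at S w) mu sigma n) +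
    m%:R * qrt (scale m) * (4 * C / sigma) + eps / 4.
  near: n.
  exact: (smoothed_le_eventually mS Snd mu0 sigma0 SC PhiM mX (ler0n _ m) (scale_gt0 m) eps4).
rewrite /Phi in Fm H2; lra.
Unshelve. all: by end_near. Qed.

End lower_bound.

(** * From the lower bound to convergence in distribution *)

Theorem theorem1p1 (R : realType) (d : measure_display) (Omega : measurableType d)
  (P : probability Omega R) (S : nat -> Omega -> R)
  (d' : measure_display) (Omega' : measurableType d')
  (P' : probability Omega' R) (W : R -> Omega' -> R) (mu sigma : R) :
  (forall k, (0 < k)%N -> measurable_fun [set: Omega] (S k)) ->
  (forall k w, (0 < k)%N -> 0 < S k w) ->
  (forall k w, (0 < k)%N -> S k w <= S k.+1 w) ->
  standard_wiener P' W ->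
  0 < mu -> 0 < sigma ->
  conv_in_distr_D P
    (fun n w t => (S0ext S (intpart (n%:R * t)) w - (intpart (n%:R * t))%:R * mu)
                  / (sigma * Num.sqrt n%:R))
    P' (fun w t => W t w) ->
  (exists C : R, forall n, (0 < n)%N ->
     (\int[P]_w (`|S n w - n%:R * mu|)%:E <= (C * Num.sqrt n%:R)%:E)%E) ->
  conv_in_distr_D P
    (fun n w t => (\prod_(1 <= k < (intpart (n%:R * t)).+1) (S k w / (k%:R * mu)))
                  `^ ((mu / sigma) / Num.sqrt n%:R))
    P' (fun w t => expR (fine (\int[lebesgue_measure]_(x in `[0%R, t]%classic) (W x w / x)%:E)%E)).
Proof.
move=> mS Sp Snd [mW [_ [Wc _]]] mu0 sigma0 XW [C SC] F [M FM] Fc.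
pose Y n w (t : R) := (\prod_(1 <= k < (intpart (n%:R * t)).+1) (S k w / (k%:R * mu)))
  `^ ((mu / sigma) / Num.sqrt n%:R).
move=> mX mY.
(* The identity is proved for every real [t], because [F] is applied to functions on the whole
   line. *)
have YE n w : Y n w = fun t => expR (logprod (S_at S w) mu sigma n t).
  apply/funext => t; rewrite /Y -expR_logprod//.
  - by congr (_ `^ _); apply: eq_big_nat => k /andP[k1 _]; case: k k1.
  - by case=> // k _; exact: Sp.
have FYE n : (fun w => F (fun t => expR (logprod (S_at S w) mu sigma n t))) =
    (fun w => F (Y n w)).
  by apply/funext => w; rewrite YE.
have mX' n : measurable_fun [set: Omega]
    (fun w => F (fun t => expR (logprod (S_at S w) mu sigma n t))).
  by rewrite FYE; exact: mX.
have NFM x : `|- F x| <= M by rewrite normrN.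
have NFc : skorokhod_continuous (fun x => - F x).
  move=> x xc e e0; have [h h0 xh] := Fc x xc e e0; exists h => // y yc xy.
  by rewrite -opprD normrN; exact: xh.
(* [Rint] unfolds to the integral of the statement, so [mY] is accepted as it is. *)
have lower := integral_lower_bound mS Snd mu0 sigma0 SC mW Wc XW FM Fc mX' mY.
have upper := integral_lower_bound mS Snd mu0 sigma0 SC mW Wc XW NFM NFc
  (fun n => measurable_funN (mX' n)) (measurable_funN mY).
have N1 n : \int[P]_w (- F (fun t => expR (logprod (S_at S w) mu sigma n t))) =
    - \int[P]_w F (fun t => expR (logprod (S_at S w) mu sigma n t)).
  under eq_Rintegral do rewrite -mulN1r.
  rewrite RintegralZl ?mulN1r//.
  exact: (bounded_integrable P (mX' n) (fun w => FM _)).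
have N2 : \int[P']_w (- F (fun t => expR (Rint (fun r => Wpath W w r / r) 0 t))) =
    - \int[P']_w F (fun t => expR (Rint (fun r => Wpath W w r / r) 0 t)).
  under eq_Rintegral do rewrite -mulN1r.
  rewrite RintegralZl ?mulN1r//.
  exact: (bounded_integrable P' mY (fun w => FM _)).
rewrite (bounded_integral_fin P' mY (fun w => FM _)).
apply: cvg_EFin.
  by apply: nearW => n; rewrite (bounded_integral_fin P (mX n) (fun w => FM _)).
apply/cvgrPdist_le => e e0; near=> n.
have /= -> : fine (\int[P]_w (F (Y n w))%:E)%E =
    \int[P]_w F (fun t => expR (logprod (S_at S w) mu sigma n t)).
  by rewrite FYE.
have l : \int[P']_w F (fun t => expR (Rint (fun r => Wpath W w r / r) 0 t)) <=
    \int[P]_w F (fun t => expR (logprod (S_at S w) mu sigma n t)) + e.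
  by near: n; exact: lower.
have u : - (\int[P']_w F (fun t => expR (Rint (fun r => Wpath W w r / r) 0 t))) <=
    - (\int[P]_w F (fun t => expR (logprod (S_at S w) mu sigma n t))) + e.
  by rewrite -N1 -N2; near: n; exact: upper.
rewrite ler_norml; apply/andP; split; lra.
Unshelve. all: by end_near. Qed.
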